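(* Assume there is $L_m>0$ with $\|J(\mu,\cdot)-J(\nu,\cdot)\|_\infty\le L_mW_1(\mu,\nu)$ for all $\mu,\nu\in\mathcal P(\Omega)$; there is $\alpha>0$ with $\langle J(\rho,\cdot)-J(\sigma,\cdot),\rho-\sigma\rangle\ge\alpha W_1(\rho,\sigma)^2$ for all $\rho,\sigma\in\mathcal P(\Omega)$; and there is $L_x>0$ with $|J(\rho,x)-J(\rho,y)|\le L_x|x-y|$ for all $\rho\in\mathcal P(\Omega)$, $x,y\in\Omega$. Let $h>0$, let $X_h=\{x_1,\dots,x_{N_h}\}\subset\Omega$ be a finite set of $N_h\ge2$ distinct points, $\delta_h:=\min_{i\neq j}|x_i-x_j|$, and let $Q_h:\Omega\to X_h$ be a measurable map with $\sup_{x\in\Omega}|Q_h(x)-x|\le h$. Let $0<\lambda<\frac1{L_mD_\Omega}$, and let $(\mu_{k,h},\nu_{k,h})_{k\ge0}$ be the KL Mirror-Prox iterates with stepsize $\lambda$ initialized from $\mu_{0,h}\in\mathcal P(X_h)$, where $\mu_{0,h}$ has full support on $X_h$. Let $\mu_h^\ast\in\mathcal P(X_h)$ be the unique solution of the finite-mesh variational inequality $\langle J(\mu_h^\ast,\cdot),\eta_h-\mu_h^\ast\rangle\ge0$ for all $\eta_h\in\mathcal P(X_h)$, and let $\mu^\ast\in\mathcal P(\Omega)$ be the continuous equilibrium, i.e. $\langle J(\mu^\ast,\cdot),\eta-\mu^\ast\rangle\ge0$ for all $\eta\in\mathcal P(\Omega)$. Define $D_{k,h}:=D_{\rm KL}(\mu_h^\ast\|\mu_{k,h})$,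 $m_h^\ast:=\min_{x\in\operatorname{supp}\mu_h^\ast}\mu_h^\ast(x)$, $$\beta:=\frac12\min\left\{\lambda\alpha,\frac{1-\lambda L_mD_\Omega}{2D_\Omega^2}\right\},\qquad \gamma_h:=\frac14\min\left\{\frac{\lambda\alpha\delta_h^2}{2},\,1-\lambda L_mD_\Omega\right\},$$ and, for $K\ge1$, $\bar\mu_{K,h}:=\frac1K\sum_{k=0}^{K-1}\mu_{k,h}$. Then the following hold. (1) There is an index $k_{0,h}\in\mathbb N$ with $k_{0,h}\le\left\lceil\frac{256D_{0,h}}{\gamma_h(m_h^\ast)^4}\right\rceil$ (one for which, for all $k\ge k_{0,h}$, $D_{k,h}\le\bigl[\frac{8}{(m_h^\ast)^2}+\frac{\gamma_h}{4}(k-k_{0,h})\bigr]^{-1}$ and $W_1(\mu_{k,h},\mu_h^\ast)\le D_\Omega\sqrt{2\bigl[\frac{8}{(m_h^\ast)^2}+\frac{\gamma_h}{4}(k-k_{0,h})\bigr]^{-1}}$) such that, for every $k\ge k_{0,h}$, $$W_1(\mu_{k,h},\mu^\ast)\le D_\Omega\sqrt{\frac{2}{\frac{8}{(m_h^\ast)^2}+\frac{\gamma_h}{4}(k-k_{0,h})}}+\sqrt{\frac{L_x}{\alpha}h}.$$ If, in addition, $\mu_h^\ast$ has full support on $X_h$, then there is an index $k_{0,h}\in\mathbb N$ with $k_{0,h}\le\left\lceil\frac{8D_{0,h}}{\gamma_h(m_h^\ast)^3}\right\rceil$ (one for which, for all $k\ge k_{0,h}$, $D_{k,h}\le\frac{(m_h^\ast)^2}{8}(1-\gamma_hm_h^\ast)^{k-k_{0,h}}$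 and $W_1(\mu_{k,h},\mu_h^\ast)\le D_\Omega\frac{m_h^\ast}{2}(1-\gamma_hm_h^\ast)^{(k-k_{0,h})/2}$) such that, for every $k\ge k_{0,h}$, $$W_1(\mu_{k,h},\mu^\ast)\le D_\Omega\frac{m_h^\ast}{2}(1-\gamma_hm_h^\ast)^{(k-k_{0,h})/2}+\sqrt{\frac{L_x}{\alpha}h}.$$ (2) For every $K\ge1$, $$\min_{0\le k\le K-1}W_1(\mu_{k,h},\mu^\ast)\le\sqrt{\frac{D_{0,h}}{\beta K}}+\sqrt{\frac{L_x}{\alpha}h}.$$ Consequently, for $\varepsilon>0$, if $h\le\frac{\alpha\varepsilon^2}{4L_x}$ and $K\ge\frac{4D_{0,h}}{\varepsilon^2\beta}$, then there exists $0\le k\le K-1$ such that $W_1(\mu_{k,h},\mu^\ast)\le\varepsilon$. (3) For every $K\ge1$, $$W_1(\bar\mu_{K,h},\mu^\ast)\le\sqrt{\frac{D_{0,h}}{\beta K}}+\sqrt{\frac{L_x}{\alpha}h}.$$ Consequently, for $\varepsilon>0$, if $h\le\frac{\alpha\varepsilon^2}{4L_x}$ and $K\ge\frac{4D_{0,h}}{\varepsilon^2\beta}$, then $W_1(\bar\mu_{K,h},\mu^\ast)\le\varepsilon$.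
   Context: $\Omega\subset\mathbb R^d$ is a nonempty compact set, $D_\Omega:=\sup_{x,y\in\Omega}|x-y|$, and $\mathcal P(\Omega)$ is the set of Borel probability measures on $\Omega$. $J:\mathcal P(\Omega)\times\Omega\to\mathbb R$ is such that $J(\mu,\cdot)\in C(\Omega)$ for every $\mu\in\mathcal P(\Omega)$. For $f\in C(\Omega)$ and a finite signed measure $\xi$, $\langle f,\xi\rangle:=\int_\Omega f\,d\xi$. $W_1$ is the 1-Wasserstein distance on $\mathcal P(\Omega)$ for the Euclidean distance. $D_{\rm KL}(\eta\|\mu):=\int\log\frac{d\eta}{d\mu}\,d\eta$ if $\eta\ll\mu$ and $+\infty$ otherwise. $\mathcal P(X_h)$ is identified with the set of measures in $\mathcal P(\Omega)$ supported on $X_h$; for $\mu\in\mathcal P(X_h)$, $\mu(x):=\mu(\{x\})$; $\mathbb N$ includes $0$; $K$ denotes an integer $\ge1$. KL Mirror-Prox iterates with stepsize $\lambda>0$ initialized from $\mu_{0,h}\in\mathcal P(X_h)$: for $k=0,1,2,\dots$ and $x\in X_h$, $$\nu_{k,h}(x)=\frac{\mu_{k,h}(x)e^{-\lambda J(\mu_{k,h},x)}}{\sum_{y\in X_h}\mu_{k,h}(y)e^{-\lambda J(\mu_{k,h},y)}},\qquad \mu_{k+1,h}(x)=\frac{\mu_{k,h}(x)e^{-\lambda J(\nu_{k,h},x)}}{\sum_{y\in X_h}\mu_{k,h}(y)e^{-\lambda J(\nu_{k,h},y)}}.$$ *)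

(* Defs.v *)
From HB Require Import structures.
From mathcomp Require Export all_boot all_order all_algebra.
From mathcomp Require Export all_classical all_reals all_analysis.
Export Order.TTheory GRing.Theory Num.Theory.
Export numFieldNormedType.Exports.

Set Implicit Arguments.
Unset Strict Implicit.
Unset Printing Implicit Defensive.

Local Open Scope classical_set_scope.
Local Open Scope ring_scope.
Local Open Scope charge_scope.

(* R^d with its Borel sets. The library norm on row vectors is the sup norm; it
   induces the same topology as the Euclidean norm, hence the same Borel sets. *)
Notation Rn R d := (g_sigma_algebraType (@open 'rV[R]_d)).

Section definitions.
Context {R : realType} {d : nat}.
Local Notation E := (Rn R d).

Definition enorm (v : 'rV[R]_d) : R := Num.sqrt (\sum_i v ord0 i ^+ 2).

Definition edist (x y : E) : R := enorm ((x : 'rV[R]_d) - (y : 'rV[R]_d)).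

Definition diam (Omega : set 'rV[R]_d) : R :=
  sup [set edist p.1 p.2 | p in Omega `*` Omega].

(* Borel probability measures on a measurable set A, viewed as the Borel
   probability measures on R^d that are carried by A. *)
Definition prob_on (A : set E) : set (probability E R) :=
  [set mu | mu A = 1%E].

Definition sup_norm (Omega : set 'rV[R]_d) (f : 'rV[R]_d -> R) : R :=
  sup [set `|f x| | x in Omega].

(* <f, rho - sigma> *)
Definition pairing (Omega : set E) (f : 'rV[R]_d -> R)
    (rho sigma : probability E R) : R :=
  \int[rho]_(x in Omega) f x - \int[sigma]_(x in Omega) f x.

Definition couplings (mu nu : set E -> \bar R) :
    set (probability (E * E)%type R) :=
  [set pi | forall A : set E, measurable A ->
     pushforward pi fst A = mu A /\ pushforward pi snd A = nu A].

(* On probability measures carried by a bounded set the infimum is finite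
   (consider the product coupling), so [fine] loses nothing there. *)
Definition W1 (mu nu : {measure set E -> \bar R}) : R :=
  fine (ereal_inf
    [set (\int[pi]_p (edist p.1 p.2)%:E)%E | pi in couplings mu nu]).

Definition KL (eta mu : probability E R) : \bar R :=
  if `[< eta `<< mu >]
  then (\int[eta]_x lne (('d (charge_of_finite_measure eta) '/d mu) x))%E
  else +oo%E.

Definition mass (mu : probability E R) (x : E) : R := fine (mu [set x]).

(* For a measure carried by a finite set these are exactly the points of its
   support. *)
Definition supp (mu : probability E R) : set E := [set x | 0 < mass mu x].

(* Below, [inf] is taken over nonempty finite sets of reals, where it is the
   minimum. *)
Definition min_mass (mu : probability E R) : R :=
  inf [set mass mu x | x in supp mu].

Definition mesh_sep (N : nat) (x : 'I_N -> E) : R :=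
  inf [set edist (x p.1) (x p.2) | p in [set p : 'I_N * 'I_N | p.1 != p.2]].

Definition solves_VI (Omega : set E) (C : set (probability E R))
    (J : probability E R -> 'rV[R]_d -> R) (mu : probability E R) : Prop :=
  C mu /\ forall eta, C eta -> 0 <= pairing Omega (J mu) eta mu.

Definition gibbs_step (N : nat) (x : 'I_N -> E) (lambda : R)
    (mu : probability E R) (f : 'rV[R]_d -> R) (nu : probability E R) : Prop :=
  forall i, mass nu (x i) =
    mass mu (x i) * expR (- lambda * f (x i)) /
    \sum_j mass mu (x j) * expR (- lambda * f (x j)).

Definition KL_mirror_prox (N : nat) (x : 'I_N -> E)
    (J : probability E R -> 'rV[R]_d -> R) (lambda : R)
    (mu nu : nat -> probability E R) : Prop :=
  forall k, [/\ prob_on (range x) (mu k), prob_on (range x) (nu k),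
    gibbs_step x lambda (mu k) (J (mu k)) (nu k) &
    gibbs_step x lambda (mu k) (J (nu k)) (mu k.+1)].

Definition average (mu : nat -> probability E R) (K : nat) :
    {measure set E -> \bar R} :=
  mscale (K%:R^-1)%:nng (msum (fun k => mu k : {measure set E -> \bar R}) K).

End definitions.

(* Main.v *)
From HB Require Import structures.
Require Import Defs.
From mathcomp Require Import measurable_realfun ring lra.

(** Measures carried by the mesh are vectors of masses, and on the mesh all the
quantities involved become finite sums: the Kullback-Leibler divergence is
the sum [rel_entropy] (lemma [KL_atomic]) and pairings are scalar products
(lemma [pairing_atomic]). Write D_k for the divergence of the discrete
equilibrium with respect to the k-th iterate.

An entropic step satisfies an exact three-point identity. Using it for the
half step and for the full step gives [mirror_prox_identity], in which the
only term of unfavourable sign is the pairing of J(nu_k) - J(mu_k) with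
nu_k - mu_{k+1}. By the Lipschitz bound on J, by W1 <= (D/2) |.|_1 and by
Pinsker's inequality ([pinsker]), this term is absorbed by the divergences of
the identity as soon as lambda Lm D < 1. Strong monotonicity of J and the
variational inequality, both used at the extrapolated point nu_k, then give
[entropy_descent]:
  D_{k+1} <= D_k - lambda alpha W1(nu_k, muh)^2 - c KL(nu_k | mu_k)
with c = 1 - lambda Lm D. Going back from nu_k to mu_k with the triangle
inequality turns the decrease into beta W1(mu_k, muh)^2 ([descent_W1]), or,
since W1 >= (delta/2) |.|_1 on a mesh whose points are delta apart, into
gamma |muh - mu_k|_1^2 ([descent_l1]).

Summing the first inequality bounds the best iterate and, W1 being convex,
the averaged iterate. In the second one the divergence has to be compared
with the l1 distance. As soon as D_k <= m^2/8, Pinsker keeps every atom of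
muh charged by mu_k up to a factor 3/4, so that ln x <= x - 1 gives
D_k <= (4/3) |.|_1 in general ([rel_entropy_le_l1]), hence a decrease
proportional to D_k^2 and the rate 1/k; and D_k <= 2/(3m) |.|_1^2 when muh
charges the whole mesh ([rel_entropy_le_l1_sqr]), hence a geometric rate.
Before that regime is reached the decrease per step is bounded below, which
bounds the entrance time ([hitting_time]).

Finally muh is close to mustar ([W1_equilibria]): the image of mustar by Q is
an admissible competitor in the discrete variational inequality, it moves
mass by at most h, and strong monotonicity bounds alpha W1(muh, mustar)^2 by
Lx h. The two errors are added with the triangle inequality for W1
([W1_triangle]). There the first and the middle measure are carried by the
mesh, so couplings are glued along the atoms of the middle measure: what is a
disintegration in general is here a division by the masses of the atoms
([W1_le_glued]). *)

Set Implicit Arguments.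
Unset Strict Implicit.
Unset Printing Implicit Defensive.

Local Open Scope classical_set_scope.
Local Open Scope ring_scope.

(** * Finite sums *)

Section finite_sums.
Context {R : realType} {I : finType}.
Implicit Types (a b x : I -> R).

Lemma cauchy_schwarz_sum a b :
  (\sum_i a i * b i) ^+ 2 <= (\sum_i a i ^+ 2) * (\sum_i b i ^+ 2).
Proof.
set A := \sum_i a i ^+ 2; set B := \sum_i a i * b i; set C := \sum_i b i ^+ 2.
have A0 : 0 <= A by apply: sumr_ge0 => i _; exact: sqr_ge0.
have key : 0 <= A * (A * C - B ^+ 2).
  have -> : A * (A * C - B ^+ 2) = \sum_i (A * b i - B * a i) ^+ 2.
    rewrite (eq_bigr (fun i => A ^+ 2 * b i ^+ 2 - 2 * A * B * (a i * b i)
       + B ^+ 2 * a i ^+ 2)); last by move=> i _; ring.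
    rewrite big_split /= sumrB -!mulr_sumr -/A -/B -/C; ring.
  by apply: sumr_ge0 => i _; exact: sqr_ge0.
move: A0; rewrite le_eqVlt => /predU1P[A_eq0|A_gt0]; last first.
  by move: key; rewrite pmulr_rge0// subr_ge0.
have a0 i : a i = 0.
  apply/eqP; rewrite -sqrf_eq0; apply/eqP.
  by apply: (psumr_eq0P (P := xpredT) (F := fun i => a i ^+ 2)) => // j _;
    exact: sqr_ge0.
rewrite /B big1 ?expr0n -?A_eq0 ?mul0r// => i _; by rewrite a0 mul0r.
Qed.

(** Cauchy-Schwarz for the families sqrt a and sqrt b. *)
Lemma sum_sqr_le x a b : (forall i, 0 <= a i) -> (forall i, 0 <= b i) ->
  (forall i, 0 <= x i) -> (forall i, x i ^+ 2 <= a i * b i) ->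
  (\sum_i x i) ^+ 2 <= (\sum_i a i) * (\sum_i b i).
Proof.
move=> a0 b0 x0 xab.
pose sa i := Num.sqrt (a i); pose sb i := Num.sqrt (b i).
have -> : \sum_i a i = \sum_i sa i ^+ 2.
  by apply: eq_bigr => i _; rewrite sqr_sqrtr.
have -> : \sum_i b i = \sum_i sb i ^+ 2.
  by apply: eq_bigr => i _; rewrite sqr_sqrtr.
apply: le_trans (cauchy_schwarz_sum sa sb).
rewrite lerXn2r ?nnegrE ?sumr_ge0//.
  by move=> i _; rewrite mulr_ge0 ?sqrtr_ge0.
apply: ler_sum => i _.
rewrite /sa /sb -sqrtrM// -[leLHS](@ger0_norm _ (x i))// -sqrtr_sqr.
exact: ler_wsqrtr.
Qed.

End finite_sums.

(** * Bounds on the logarithm *)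

Section log_bounds.
Context {R : realType}.
Implicit Types x y : R.

(** The difference of the two sides vanishes at 1, and its derivative is
(x - 1)^3 / (x^2 (x + 2)^2), which has the sign of x - 1. This bound is exactly
what makes Pinsker's inequality hold term by term with its sharp constant. *)
Lemma ln_pade_lower x : 0 < x ->
  (x - 1) * (5 * x + 1) / (2 * x * (x + 2)) <= ln x.
Proof.
move=> x0.
pose g (y : R) := ln y - (y - 1) * (5 * y + 1) / (2 * y * (y + 2)).
pose dg (y : R) := (y - 1) ^+ 3 / (y ^+ 2 * (y + 2) ^+ 2).
have dgE y : 0 < y -> is_derive y 1 g (dg y).
  move=> y0.
  have ynz : y != 0 by rewrite gt_eqF.
  have y2nz : y + 2 != 0 by rewrite gt_eqF// addr_gt0.
  have dnz : 2 * y * (y + 2) != 0 by rewrite !mulf_neq0// pnatr_eq0.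
  have dln := is_derive1_ln y0.
  have dden : is_derive y 1 (fun t : R => (2 * t * (t + 2))^-1)
    (- (2 * y * (y + 2)) ^- 2 *: (4 * y + 4)).
    apply: (@is_deriveV R (fun t : R => 2 * t * (t + 2))) => //.
    by apply: is_derive_eq; rewrite /GRing.scale /=; ring.
  have dnum : is_derive y 1 (fun t : R => (t - 1) * (5 * t + 1)) (10 * y - 4).
    by apply: is_derive_eq; rewrite /GRing.scale /=; ring.
  apply: (is_derive_eq (is_deriveB dln (is_deriveM dnum dden))).
  by rewrite /dg /GRing.scale /=; field; rewrite ynz y2nz.
have cg a b : 0 < a -> {within `[a, b], continuous g}.
  move=> a0; apply: derivable_within_continuous => y /itvP yab.
  by apply: ex_derive; apply: dgE; rewrite (lt_le_trans a0)// yab.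
have g1 : g 1 = 0 by rewrite /g ln1 subrr !mul0r subrr.
suff : 0 <= g x by rewrite /g subr_ge0.
have dgge0 (c : R) : 0 <= c ^+ 2 * (c + 2) ^+ 2.
  by apply: mulr_ge0; exact: sqr_ge0.
have [x1|x1] := leP x 1.
  have [|c /itvP cx] := @MVT_segment R g dg x 1 x1 _ (cg _ _ x0).
    by move=> y /itvP yx; apply: dgE; rewrite (lt_trans x0)// yx.
  have c0 : 0 < c by rewrite (lt_le_trans x0)// cx.
  rewrite g1 sub0r => /eqP; rewrite eqr_oppLR => /eqP ->.
  rewrite oppr_ge0 mulr_le0_ge0 ?subr_ge0// /dg mulr_le0_ge0 ?invr_ge0 ?dgge0//.
  by rewrite exprS mulr_le0_ge0 ?sqr_ge0// subr_le0 cx.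
have [|c /itvP cx] := @MVT_segment R g dg 1 x (ltW x1) _ (cg _ _ ltr01).
  by move=> y /itvP yx; apply: dgE; rewrite (lt_trans ltr01)// yx.
have c1 : 1 <= c by rewrite cx.
rewrite g1 subr0 => ->; rewrite mulr_ge0 ?subr_ge0 ?(ltW x1)//.
rewrite /dg divr_ge0 ?dgge0//.
by rewrite exprn_ge0// subr_ge0.
Qed.

Lemma ln_le_sub1 x : 0 < x -> ln x <= x - 1.
Proof.
move=> x0; rewrite -[in ln x](subrK 1 x) addrC le_ln1Dx//.
by rewrite ltrBrDr addNr.
Qed.

(** The pointwise inequality behind Pinsker's: after division by y^2 it is
[ln_pade_lower] at x / y. *)
Lemma relative_entropy_term x y : 0 <= x -> 0 < y ->
  3 * (x - y) ^+ 2 <= (2 * x + 4 * y) * (x * ln (x / y) - x + y).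
Proof.
move=> x0 y0; move: x0; rewrite le_eqVlt => /predU1P[<-|x0].
  by rewrite !mul0r; nra.
have xy0 : 0 < x / y by rewrite divr_gt0.
have := ln_pade_lower xy0.
have -> : (x / y - 1) * (5 * (x / y) + 1) / (2 * (x / y) * (x / y + 2)) =
  (x - y) * (5 * x + y) / (x * (2 * x + 4 * y)).
  by field; rewrite ?gt_eqF//= ?(addr_gt0, mulr_gt0)//; apply/andP.
rewrite ler_pdivrMr ?(mulr_gt0, addr_gt0)//.
set l := ln _ => hl.
have -> : (2 * x + 4 * y) * (x * l - x + y) =
  l * (x * (2 * x + 4 * y)) - (2 * x + 4 * y) * (x - y) by ring.
nra.
Qed.

End log_bounds.

(** * Probability vectors and relative entropy *)

Section probability_vectors.
Context {R : realType} {I : finType}.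
Implicit Types (p q s f : I -> R).

Definition prob_vec p := (forall i, 0 <= p i) /\ \sum_i p i = 1.

Definition l1_dist p q : R := \sum_i `|p i - q i|.

Definition rel_entropy p q : R := \sum_i p i * ln (p i / q i).

Lemma l1_dist_ge0 p q : 0 <= l1_dist p q.
Proof. by rewrite sumr_ge0. Qed.

Lemma l1_distC p q : l1_dist p q = l1_dist q p.
Proof. by apply: eq_bigr => i _; rewrite distrC. Qed.

Lemma l1_dist_triangle p q s : l1_dist p s <= l1_dist p q + l1_dist q s.
Proof. by rewrite -big_split /= ler_sum// => i _; rewrite ler_distD. Qed.

(** [sum_sqr_le] applied to [relative_entropy_term]: the weights
(2 p + 4 q) / 3 have total mass 2, and the corrections - p + q sum to 0. *)
Lemma pinsker p q : prob_vec p -> prob_vec q -> (forall i, 0 < q i) ->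
  l1_dist p q ^+ 2 <= 2 * rel_entropy p q.
Proof.
move=> [p0 p1] [_ q1] q0.
pose a i := (2 * p i + 4 * q i) / 3.
pose b i := p i * ln (p i / q i) - p i + q i.
have a0 i : 0 < a i by rewrite /a; have := p0 i; have := q0 i; lra.
have ab i : `|p i - q i| ^+ 2 <= a i * b i.
  have := relative_entropy_term (p0 i) (q0 i).
  by rewrite real_normK ?num_real// /a /b; nra.
have b0 i : 0 <= b i.
  by rewrite -(pmulr_rge0 _ (a0 i)); apply: le_trans (ab i); exact: sqr_ge0.
have := sum_sqr_le (fun i => ltW (a0 i)) b0 (fun i => normr_ge0 _) ab.
rewrite -/(l1_dist p q) => /le_trans; apply.
have -> : \sum_i a i = 2.
  by rewrite -mulr_suml big_split/= -!mulr_sumr p1 q1; lra.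
rewrite /b big_split/= sumrB p1 q1 -/(rel_entropy p q); lra.
Qed.

Lemma rel_entropy_ge0 p q : prob_vec p -> prob_vec q -> (forall i, 0 < q i) ->
  0 <= rel_entropy p q.
Proof.
move=> pp pq q0; have := pinsker pp pq q0.
by have := sqr_ge0 (l1_dist p q); lra.
Qed.

(** The differences p - q sum to 0, so one of them cannot exceed the sum of the
others in absolute value; this gains the factor 1/2. *)
Lemma coord_le_l1_dist p q i : prob_vec p -> prob_vec q ->
  `|p i - q i| <= l1_dist p q / 2.
Proof.
move=> [_ p1] [_ q1].
have : \sum_j (p j - q j) = 0 by rewrite sumrB p1 q1 subrr.
rewrite (bigD1 i)//= /l1_dist [in leRHS](bigD1 i)//= => /eqP.
rewrite addr_eq0 => /eqP pqi.
have : `|p i - q i| <= \sum_(j | j != i) `|p j - q j|.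
  by rewrite pqi normrN ler_norm_sum.
lra.
Qed.

Lemma sum_sqr_le_l1_dist p q : prob_vec p -> prob_vec q ->
  \sum_i (p i - q i) ^+ 2 <= l1_dist p q ^+ 2 / 2.
Proof.
move=> pp pq; rewrite expr2 mulrAC mulr_sumr ler_sum// => i _.
rewrite -real_normK ?num_real// expr2 ler_wpM2r//.
exact: coord_le_l1_dist.
Qed.

Lemma le_rel_entropy_chi2 p q : (forall i, 0 <= p i) -> (forall i, 0 < q i) ->
  rel_entropy p q <= \sum_i p i * (p i - q i) / q i.
Proof.
move=> p0 q0; apply: ler_sum => i _.
have := p0 i; rewrite le_eqVlt => /predU1P[<-|pi0]; first by rewrite !mul0r.
rewrite -mulrA ler_wpM2l//.
apply: le_trans (ln_le_sub1 _) _; rewrite ?divr_gt0//.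
by rewrite mulrBl divff// gt_eqF.
Qed.

Section near_atoms.
Variables (m : R) (p q : I -> R).
Hypotheses (pp : prob_vec p) (pq : prob_vec q) (q0 : forall i, 0 < q i).
Hypotheses (m0 : 0 < m) (l1m : l1_dist p q <= m / 2).

Let q_ge i : m <= p i -> 3 / 4 * p i <= q i.
Proof.
move=> mp; have := coord_le_l1_dist i pp pq.
move=> /ler_normlW h; have := l1m; lra.
Qed.

(** Each atom of p satisfies q >= (3/4) p, which replaces the denominators of
the chi-square bound by a constant. *)
Lemma rel_entropy_le_l1 : (forall i, 0 < p i -> m <= p i) ->
  rel_entropy p q <= 4 / 3 * l1_dist p q.
Proof.
move=> pm; apply: le_trans (le_rel_entropy_chi2 pp.1 q0) _.
rewrite mulr_sumr ler_sum// => i _.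
have := pp.1 i; rewrite le_eqVlt => /predU1P[<-|pi0].
  by rewrite !mul0r mulr_ge0.
rewrite ler_pdivrMr//.
have qi := q_ge (pm _ pi0).
have := ler_norm (p i - q i); have := normr_ge0 (p i - q i).
by have := q0 i; nra.
Qed.

(** When p has full support the chi-square bound is quadratic, because
sum_i (p i - q i) = 0 turns p (p - q) / q into (p - q)^2 / q. *)
Lemma rel_entropy_le_l1_sqr : (forall i, m <= p i) ->
  rel_entropy p q <= 2 / (3 * m) * l1_dist p q ^+ 2.
Proof.
move=> pm; apply: le_trans (le_rel_entropy_chi2 pp.1 q0) _.
have -> : \sum_i p i * (p i - q i) / q i = \sum_i (p i - q i) ^+ 2 / q i.
  apply/eqP; rewrite -subr_eq0 -sumrB.
  rewrite (eq_bigr (fun i => p i - q i)); last first.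
    by move=> i _; field; rewrite gt_eqF.
  by rewrite sumrB pp.2 pq.2 subrr.
apply: (@le_trans _ _ (4 / (3 * m) * \sum_i (p i - q i) ^+ 2)).
  rewrite mulr_sumr ler_sum// => i _; rewrite mulrC ler_wpM2r ?sqr_ge0//.
  rewrite -[leRHS]invrK lef_pV2 ?posrE ?invr_gt0 ?divr_gt0 ?mulr_gt0//.
  have := q_ge (pm i); have := pm i.
  by rewrite invf_div; lra.
have -> : 2 / (3 * m) * l1_dist p q ^+ 2 =
    4 / (3 * m) * (l1_dist p q ^+ 2 / 2) by field; rewrite gt_eqF.
by rewrite ler_wpM2l ?divr_ge0 ?mulr_ge0 ?(ltW m0)// sum_sqr_le_l1_dist.
Qed.

End near_atoms.

(** * The entropic step *)

Definition gibbs_vec (lambda : R) p f q :=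
  forall i, q i = p i * expR (- lambda * f i) /
                  \sum_j p j * expR (- lambda * f j).

Section gibbs.
Variables (lambda : R) (p f q : I -> R).
Hypotheses (pp : prob_vec p) (p0 : forall i, 0 < p i).
Hypothesis (gq : gibbs_vec lambda p f q).

Let Z := \sum_j p j * expR (- lambda * f j).

Let Z_gt0 : 0 < Z.
Proof.
have [i _|I0] := pickP (@predT I); last first.
  by move: pp.2; rewrite big_pred0// => /eqP; rewrite eq_sym oner_eq0.
rewrite /Z (bigD1 i)//= ltr_pwDl ?mulr_gt0 ?expR_gt0// sumr_ge0// => j _.
by rewrite mulr_ge0 ?expR_ge0// ltW.
Qed.

Lemma gibbs_vec_gt0 i : 0 < q i.
Proof. by rewrite gq divr_gt0 ?mulr_gt0 ?expR_gt0. Qed.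

Lemma prob_gibbs_vec : prob_vec q.
Proof.
split=> [i|]; first exact/ltW/gibbs_vec_gt0.
rewrite (eq_bigr _ (fun i _ => gq i)) -mulr_suml divff// gt_eqF//.
Qed.

Let ln_gibbs i : ln (q i / p i) = - lambda * f i - ln Z.
Proof.
have -> : q i / p i = expR (- lambda * f i) / Z.
  by rewrite gq -/Z; field; rewrite !gt_eqF//= ?Z_gt0.
by rewrite ln_div ?posrE ?expR_gt0 ?Z_gt0// expRK.
Qed.

(** ln (q / p) is affine in f, so the log-partition function cancels out
when the divergences are combined. *)
Lemma gibbs_three_points z : prob_vec z ->
  rel_entropy z q =
  rel_entropy z p - rel_entropy q p - lambda * \sum_i f i * (q i - z i).
Proof.
move=> [z0 z1].
have qp : rel_entropy q p = - lambda * (\sum_i f i * q i) - ln Z.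
  rewrite /rel_entropy.
  rewrite (eq_bigr (fun i => - lambda * (f i * q i) - q i * ln Z)); last first.
    by move=> i _; rewrite ln_gibbs; ring.
  by rewrite sumrB -mulr_sumr -mulr_suml prob_gibbs_vec.2 mul1r.
have zq : rel_entropy z p - rel_entropy z q =
    - lambda * (\sum_i f i * z i) - ln Z.
  rewrite /rel_entropy -sumrB.
  rewrite (eq_bigr (fun i => - lambda * (f i * z i) - z i * ln Z)); last first.
    move=> i _; have := z0 i; rewrite le_eqVlt => /predU1P[<-|zi0].
      by rewrite !mul0r mulr0; ring.
    have qi := gibbs_vec_gt0 i.
    have -> : ln (z i / p i) = ln (z i / q i) + ln (q i / p i).
      rewrite -lnM ?posrE ?divr_gt0//; congr ln.
      by field; rewrite !gt_eqF.
    by rewrite ln_gibbs; ring.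
  by rewrite sumrB -mulr_sumr -mulr_suml z1 mul1r.
have -> : \sum_i f i * (q i - z i) = \sum_i f i * q i - \sum_i f i * z i.
  by rewrite -sumrB; apply: eq_bigr => i _; ring.
move: zq; rewrite qp; lra.
Qed.

End gibbs.

(** Three-point identity for the full step at z, plus the one for the half step
at the new iterate r. *)
Lemma mirror_prox_identity (lambda : R) p f q g r z :
  prob_vec p -> (forall i, 0 < p i) -> prob_vec z ->
  gibbs_vec lambda p f q -> gibbs_vec lambda p g r ->
  rel_entropy z r = rel_entropy z p - lambda * (\sum_i g i * (q i - z i))
    - rel_entropy r q - rel_entropy q p
    + lambda * \sum_i (g i - f i) * (q i - r i).
Proof.
move=> pp p0 pz gq gr.
have rP := prob_gibbs_vec pp p0 gr.
have := gibbs_three_points pp p0 gr pz; have := gibbs_three_points pp p0 gq rP.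
have -> : \sum_i (g i - f i) * (q i - r i) =
  (\sum_i g i * (q i - z i)) - (\sum_i g i * (r i - z i))
   - \sum_i f i * (q i - r i).
  by rewrite -!sumrB; apply: eq_bigr => i _; ring.
lra.
Qed.

End probability_vectors.

(** * Decreasing sequences *)

Section recursions.
Context {R : realType}.
Implicit Types (u : nat -> R).

(** A loss of e per step can last at most u 0 / e steps. *)
Lemma hitting_time u (T e : R) : 0 <= u 0%N -> 0 < e -> 0 <= T ->
  (forall k, T < u k -> u k.+1 <= u k - e) ->
  exists2 k0 : nat, k0%:Z <= Num.ceil (u 0%N / e) & u k0 <= T.
Proof.
move=> u0 e0 T0 ue.
have c0 : 0 <= Num.ceil (u 0%N / e).
  by rewrite -(@ler_int R) (le_trans _ (ceil_ge _))// divr_ge0// ltW.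
pose n := `|Num.ceil (u 0%N / e)|%N.
have nE : n%:Z = Num.ceil (u 0%N / e) by rewrite /n gez0_abs.
case: (pselect (exists2 k0 : nat, (k0 <= n)%N & u k0 <= T)).
  by move=> [k0 k0n k0T]; exists k0 => //; rewrite -nE lez_nat.
move=> no; exfalso; apply: (no); exists n => //.
have dec k : (k <= n)%N -> u k <= u 0%N - k%:R * e.
  elim: k => [|k ih] kn; first by rewrite mul0r subr0.
  have Tk : T < u k.
    by rewrite ltNge; apply/negP => kT; apply: no; exists k => //; exact: ltnW.
  by have := ue k Tk; have := ih (ltnW kn); rewrite -natr1; lra.
apply: le_trans (dec n (leqnn n)) (le_trans _ T0).
rewrite subr_le0 -ler_pdivrMr//.
by apply: le_trans (ceil_ge _) _; rewrite -nE.
Qed.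

(** Formally 1/u increases by at least g at each step; the statement multiplied
out, u (r + g k) <= 1, also covers u = 0. *)
Lemma reciprocal_decay u (r g : R) : 0 < r -> 0 < g -> (forall k, 0 <= u k) ->
  u 0%N <= r^-1 -> (forall k, u k.+1 <= u k - g * u k ^+ 2) ->
  forall k, u k <= (r + g * k%:R)^-1.
Proof.
move=> r0 g0 u0 ur uS.
have rg k : 0 < r + g * k%:R by rewrite ltr_pwDl// mulr_ge0// ltW.
suff h k : u k * (r + g * k%:R) <= 1.
  by move=> k; rewrite -[leRHS]div1r ler_pdivlMr.
elim: k => [|k ih]; first by rewrite mulr0 addr0 -ler_pdivlMr// div1r.
have -> : r + g * k.+1%:R = (r + g * k%:R) + g by rewrite -natr1; ring.
move: ih; set t := r + _; have t0 : 0 < t := rg k.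
have := uS k; have := u0 k; have := u0 k.+1.
set x := u k; set y := u k.+1 => y0 x0 yx xt.
(* as x t <= 1, the product is at most (1 - g x) (1 + g x) <= 1 *)
have gx : 0 <= 1 - g * x.
  rewrite leNgt; apply/negP => gx1.
  have : 0 < x.
    rewrite lt_neqAle x0 andbT; apply/eqP => xE.
    by move: gx1; rewrite -xE mulr0 subr0 ltr10.
  by nra.
have h1 : y * (t + g) <= (x - g * x ^+ 2) * (t + g).
  by rewrite ler_wpM2r// ltW// addr_gt0.
apply: le_trans h1 _.
have -> : (x - g * x ^+ 2) * (t + g) = (1 - g * x) * (x * t + g * x) by ring.
apply: (@le_trans _ _ ((1 - g * x) * (1 + g * x))).
  by rewrite ler_wpM2l// lerD2r.
have := sqr_ge0 (g * x); lra.
Qed.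

Lemma geometric_decay u (c a : R) : 0 <= a -> u 0%N <= c ->
  (forall k, u k.+1 <= a * u k) -> forall k, u k <= c * a ^+ k.
Proof.
move=> a0 uc uS; elim=> [|k ih]; first by rewrite expr0 mulr1.
apply: le_trans (uS k) _.
by rewrite exprS mulrCA ler_wpM2l.
Qed.

End recursions.

(** * Mixtures and image measures *)

Section mixtures.
Context {R : realType} d (T : measurableType d) {I : finType}.
Implicit Types (w : I -> {nonneg R}) (m : I -> {measure set T -> \bar R}).

(** Finite combinations indexed by an arbitrary finite type, while [msum] is
indexed by integers; the couplings below are indexed by pairs of mesh points. *)
Definition mixture w m : {measure set T -> \bar R} :=
  msum (nth (mzero : {measure set T -> \bar R})
    [seq (mscale (w i) (m i) : {measure set T -> \bar R}) | i <- enum I]) #|I|.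

Let sum_nth w m (F : {measure set T -> \bar R} -> \bar R) :
  (\sum_(k < #|I|) F (nth (mzero : {measure set T -> \bar R})
     [seq (mscale (w i) (m i) : {measure set T -> \bar R}) | i <- enum I] k) =
  \sum_i F (mscale (w i) (m i)))%E.
Proof.
set s := map _ _; transitivity (\sum_(mu <- s) F mu)%E.
  rewrite (big_nth (mzero : {measure set T -> \bar R})) size_map -cardE.
  by rewrite big_mkord.
by rewrite big_map big_enum.
Qed.

Lemma mixtureE w m A :
  mixture w m A = (\sum_i (w i)%:num%:E * m i A)%E.
Proof. by rewrite /mixture /= /msum (sum_nth w m (fun mu => mu A)). Qed.

Lemma ge0_integral_mixture w m (f : T -> \bar R) :
  measurable_fun setT f -> (forall x, 0 <= f x)%E ->
  (\int[mixture w m]_x f x = \sum_i (w i)%:num%:E * \int[m i]_x f x)%E.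
Proof.
move=> mf f0; rewrite ge0_integral_measure_sum//.
rewrite (sum_nth w m (fun mu : {measure set T -> \bar R} => \int[mu]_x f x)%E).
by apply: eq_bigr => i _; rewrite ge0_integral_mscale.
Qed.

End mixtures.

Section probability_of_measure.
Context {R : realType} d (T : measurableType d).
Variables (mu : {measure set T -> \bar R}) (mu1 : mu setT = 1%E).

Definition probability_of_measure of mu setT = 1%E : set T -> \bar R := mu.
Local Notation P := (probability_of_measure mu1).

HB.instance Definition _ := isMeasure.Build _ _ _ P (measure0 mu)
  (measure_ge0 mu) (@measure_semi_sigma_additive _ _ _ mu).

HB.instance Definition _ := Measure_isProbability.Build _ _ _ P mu1.

End probability_of_measure.

Section image_measure.
Context {R : realType} d d' (T : measurableType d) (U : measurableType d').

(** The measurability proof is an argument, so that the measure structure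
of [pushforward] can be used in term position. *)
Definition image_measure (mu : {measure set T -> \bar R}) (f : T -> U)
  (mf : measurable_fun setT f) : {measure set U -> \bar R}.
Proof. by refine (pushforward mu f : {measure set U -> \bar R}). Defined.

Definition image_probability (P : probability T R) (f : T -> U)
    (mf : measurable_fun setT f) : probability U R :=
  probability_of_measure (mu := image_measure P mf) (probability_setT P).

Lemma ge0_integral_image (mu : {measure set T -> \bar R}) (f : T -> U)
    (mf : measurable_fun setT f) (g : U -> \bar R) :
  measurable_fun setT g -> (forall y, 0 <= g y)%E ->
  (\int[image_measure mu mf]_y g y = \int[mu]_x g (f x))%E.
Proof. by move=> mg g0; rewrite ge0_integral_pushforward. Qed.

End image_measure.



(** * Atomic measures *)

Section carried_by_pieces.
Context {R : realType} d (T : measurableType d) {I : finType}.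
Variables (P : probability T R) (F : I -> set T).
Hypotheses (mF : forall i, measurable (F i)) (tF : trivIset setT F).
Hypothesis PF : P (\bigcup_i F i) = 1%E.

Lemma prob_carried_by_pieces A : measurable A ->
  P A = (\sum_i P (A `&` F i))%E.
Proof.
move=> mA.
have mU : measurable (\bigcup_i F i) by exact: fin_bigcup_measurable.
have PC : P (~` \bigcup_i F i) = 0%E by rewrite probability_setC// PF subee.
have -> : P A = P (A `&` \bigcup_i F i).
  rewrite -[in LHS](setIT A) -(setUv (\bigcup_i F i)) setIUr measureU//.
  - rewrite [X in (_ + X)%E](_ : _ = 0%E) ?adde0//.
    apply: (subset_measure0 _ _ _ PC) => //; last exact: measurableC.
    by apply: measurableI => //; exact: measurableC.
  - exact: measurableI.
  - by apply: measurableI => //; exact: measurableC.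
  - by rewrite setIACA setICr setI0.
rewrite setI_bigcupr measure_fin_bigcup//=.
- have -> : [set: I] = [set` predT] by apply/seteqP; split.
  rewrite -(@bigfs _ _ _ _ (index_enum I)) ?index_enum_uniq//.
  by move=> i _; rewrite mem_index_enum.
- exact: trivIset_setIl.
- by move=> i _; exact: measurableI.
Qed.

End carried_by_pieces.

Section atomic.
Context {R : realType} d (T : measurableType d) {I : finType}.
Hypothesis measurable_singleton : forall x : T, measurable [set x].
Implicit Types (X : I -> T) (p : I -> R).

(** Only the values on measurable sets matter, which are all that integrals
depend on. *)
Definition atomic X p (mu : set T -> \bar R) :=
  forall A, measurable A -> mu A = (\sum_i (p i)%:E * \d_(X i) A)%E.

Lemma measurable_range X : measurable (range X).
Proof.
rewrite -bigcup_imset1; apply: fin_bigcup_measurable => //.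
Qed.

Lemma prob_range_atomic X (mu : probability T R) : injective X ->
  mu (range X) = 1%E -> atomic X (fun i => fine (mu [set X i])) mu.
Proof.
move=> Xinj mu1 A mA.
rewrite (@prob_carried_by_pieces _ _ _ _ mu (fun i => [set X i]))//.
- apply: eq_bigr => i _.
  rewrite diracE; have [XA|XA] := boolP (X i \in A).
    by rewrite setIidr ?fineK ?fin_num_measure ?mule1// => _ ->; exact: set_mem.
  rewrite mule0 (_ : _ `&` _ = set0) ?measure0//.
  rewrite -subset0 => y [] /mem_set Ay yX.
  by move: XA; rewrite -yX Ay.
- apply/trivIsetP => i j _ _ ij; rewrite -subset0 => x [/= -> /Xinj ij'].
  by move: ij; rewrite ij' eqxx.
- by rewrite bigcup_imset1.
Qed.

Lemma atomic_mass X p mu i : injective X -> atomic X p mu ->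
  mu [set X i] = (p i)%:E.
Proof.
move=> Xinj /(_ _ (measurable_singleton (X i))) ->.
rewrite (bigD1 i)//= diracE mem_set// mule1 big1 ?adde0// => j ji.
rewrite diracE memNset ?mule0//= => /Xinj/eqP.
by rewrite (negbTE ji).
Qed.

Lemma atomicT X p mu : atomic X p mu -> mu setT = (\sum_i p i)%:E.
Proof.
move=> /(_ _ measurableT) ->; rewrite -sumEFin; apply: eq_bigr => i _.
by rewrite diracT mule1.
Qed.

Lemma prob_vec_atomic X (mu : probability T R) : injective X ->
  mu (range X) = 1%E -> prob_vec (fun i => fine (mu [set X i])).
Proof.
move=> Xinj mu1; split=> [i|]; first exact: fine_ge0.
apply: EFin_inj; rewrite -(atomicT (prob_range_atomic Xinj mu1)).
by rewrite probability_setT.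
Qed.

Lemma atomic_range X p mu : atomic X p mu -> mu (range X) = (\sum_i p i)%:E.
Proof.
move=> /(_ _ (measurable_range X)) ->; rewrite -sumEFin; apply: eq_bigr => i _.
by rewrite diracE mem_set ?mule1//; exists i.
Qed.

Lemma ge0_integral_atomic X p (mu : {measure set T -> \bar R}) D
    (f : T -> \bar R) :
  (forall i, 0 <= p i) -> atomic X p mu -> measurable D ->
  (forall i, D (X i)) -> measurable_fun D f -> (forall x, D x -> 0 <= f x)%E ->
  (\int[mu]_(x in D) f x = \sum_i (p i)%:E * f (X i))%E.
Proof.
move=> p0 Xmu mD DX mf f0.
pose w i := NngNum (p0 i).
pose dX i : {measure set T -> \bar R} := \d_(X i).
rewrite (@eq_measure_integral _ _ _ D (mixture w dX)); last first.
  by move=> A mA _; rewrite Xmu// mixtureE.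
rewrite integral_mkcond ge0_integral_mixture; last 2 first.
- exact/(measurable_restrictT _ _).1.
- by move=> x; apply: erestrict_ge0.
apply: eq_bigr => i _; rewrite /= -integral_mkcond integral_dirac//.
by rewrite diracE mem_set ?mul1e.
Qed.

(** The function f may be infinite where p vanishes, as the logarithm of a
density is: 0 times infinity is 0. Positive and negative parts are summed
separately. *)
Lemma integral_atomic X p (mu : {measure set T -> \bar R}) D
    (f : T -> \bar R) (g : I -> R) :
  (forall i, 0 <= p i) -> atomic X p mu -> measurable D ->
  (forall i, D (X i)) -> measurable_fun D f ->
  (forall i, p i != 0 -> f (X i) = (g i)%:E) ->
  (\int[mu]_(x in D) f x = (\sum_i p i * g i)%:E)%E.
Proof.
move=> p0 Xmu mD DX mf fg.
have pf i : ((p i)%:E * f (X i) = (p i * g i)%:E)%E.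
  have [->|pi0] := eqVneq (p i) 0; first by rewrite mul0r mul0e.
  by rewrite fg// EFinM.
rewrite integralE.
rewrite (ge0_integral_atomic p0 Xmu)//; last exact/measurable_funepos.
rewrite (ge0_integral_atomic p0 Xmu)//; last exact/measurable_funeneg.
rewrite (eq_bigr (fun i => (p i * Num.max (g i) 0)%:E)); last first.
  move=> i _; have [->|pi0] := eqVneq (p i) 0; first by rewrite mul0r mul0e.
  by rewrite funeposE fg// EFinM EFin_max.
rewrite [X in (_ - X)%E](eq_bigr (fun i => (p i * Num.max (- g i) 0)%:E));
  last first.
  move=> i _; have [->|pi0] := eqVneq (p i) 0; first by rewrite mul0r mul0e.
  by rewrite funenegE fg// EFinM EFin_max.
rewrite !sumEFin -EFinB -sumrB; congr EFin; apply: eq_bigr => i _.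
rewrite -mulrBr; congr (_ * _).
by rewrite /Num.max; case: ltP => ?; case: ltP => ?; lra.
Qed.

End atomic.

(** * Euclidean distance and Borel sets of R^d *)

Section euclidean_distance.
Context {R : realType} {d : nat}.
Local Notation E := (Rn R d).
Implicit Types (x y z : E) (u v : 'rV[R]_d).

Lemma enorm_ge0 u : 0 <= enorm u.
Proof. exact: sqrtr_ge0. Qed.

Lemma sqr_enorm u : enorm u ^+ 2 = \sum_i u ord0 i ^+ 2.
Proof. by rewrite sqr_sqrtr// sumr_ge0// => i _; exact: sqr_ge0. Qed.

Lemma ler_enormD u v : enorm (u + v) <= enorm u + enorm v.
Proof.
have uv0 : 0 <= enorm u + enorm v by rewrite addr_ge0 ?enorm_ge0.
rewrite -(ler_pXn2r (n := 2))// ?nnegrE ?enorm_ge0//.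
have CS : \sum_i u ord0 i * v ord0 i <= enorm u * enorm v.
  have := @cauchy_schwarz_sum R _ (u ord0) (v ord0).
  rewrite -!sqr_enorm -exprMn => /ler_wsqrtr.
  rewrite !sqrtr_sqr (ger0_norm (mulr_ge0 (enorm_ge0 u) (enorm_ge0 v))).
  exact: le_trans (ler_norm _).
rewrite sqrrD !sqr_enorm.
rewrite (eq_bigr (fun i => u ord0 i ^+ 2 + v ord0 i ^+ 2
    + 2 * (u ord0 i * v ord0 i))); last by move=> i _; rewrite mxE; ring.
rewrite !big_split/= -mulr_sumr; lra.
Qed.

Lemma edist_ge0 x y : 0 <= edist x y. Proof. exact: enorm_ge0. Qed.

Lemma edistxx x : edist x x = 0.
Proof.
by rewrite /edist subrr /enorm big1 ?sqrtr0// => i _; rewrite mxE expr0n.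
Qed.

Lemma edist_triangle y x z : edist x z <= edist x y + edist y z.
Proof.
rewrite /edist (_ : _ - _ = ((x : 'rV[R]_d) - y) + ((y : 'rV[R]_d) - z)).
  exact: ler_enormD.
by rewrite addrA subrK.
Qed.

Lemma edist_gt0 x y : x != y -> 0 < edist x y.
Proof.
move=> xy; rewrite lt_neqAle edist_ge0 andbT; apply: contra xy => /eqP.
move=> /esym xy0; apply/eqP/matrixP => i j; rewrite ord1; apply/eqP.
rewrite -subr_eq0 -sqrf_eq0; apply/eqP.
have : enorm ((x : 'rV[R]_d) - (y : 'rV[R]_d)) ^+ 2 = 0.
  by rewrite -/(edist x y) xy0 expr0n.
rewrite sqr_enorm => /psumr_eq0P => /(_ (fun i _ => sqr_ge0 _)) /(_ j isT).
by rewrite !mxE.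
Qed.

Lemma closed_measurable (A : set 'rV[R]_d) :
  closed A -> measurable (A : set E).
Proof.
move=> cA; rewrite -(setCK A); apply: measurableC.
by apply: sub_sigma_algebra; exact: closed_openC.
Qed.

Lemma compact_measurable_rV (A : set 'rV[R]_d) :
  compact A -> measurable (A : set E).
Proof.
move=> cA; apply: closed_measurable; exact: compact_closed.
Qed.

Lemma measurable_singleton x : measurable [set x].
Proof.
apply: closed_measurable; apply: accessible_closed_set1.
by apply: hausdorff_accessible; exact: norm_hausdorff.
Qed.

Lemma within_continuous_measurable (A : set 'rV[R]_d) (f : 'rV[R]_d -> R) :
  measurable (A : set E) -> {within A, continuous f} ->
  measurable_fun (A : set E) f.
Proof.
move=> mA cf; apply: (measurability _ (RGenOpens.measurableE R)).
move=> _ [_ [a [b ->] <-]].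
have /open_subspaceP[V oV VA] : open (f @^-1` `]a, b[ : set (subspace A)).
  by move/continuousP : cf; apply; exact: interval_open.
rewrite setIC -VA; apply: measurableI => //; exact: sub_sigma_algebra.
Qed.

Lemma measurable_coord i :
  measurable_fun (setT : set E) (fun x : 'rV[R]_d => x ord0 i).
Proof.
apply: within_continuous_measurable => //.
by apply: continuous_subspaceT => x; exact: coord_continuous.
Qed.

Lemma measurable_edist :
  measurable_fun setT (fun p : E * E => edist p.1 p.2).
Proof.
apply: (@measurableT_comp _ _ _ _ _ _ (@Num.sqrt R)).
  by apply: continuous_measurable_fun; exact: sqrt_continuous.
apply: measurable_sum => i; apply: measurable_funX.
rewrite (_ : (fun _ => _) = (fun p : E * E =>
    (p.1 : 'rV[R]_d) ord0 i - (p.2 : 'rV[R]_d) ord0 i)); last first.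
  by apply/funext => p; rewrite !mxE.
apply: measurable_funB.
- exact: (measurableT_comp (measurable_coord i) measurable_fst).
- exact: (measurableT_comp (measurable_coord i) measurable_snd).
Qed.

Lemma measurable_eedist :
  measurable_fun setT (fun p : E * E => (edist p.1 p.2)%:E).
Proof. by apply/measurable_EFinP; exact: measurable_edist. Qed.

Section diameter.
Variables (Omega : set 'rV[R]_d) (Omega_compact : compact Omega).

Lemma edist_le_diam x y : Omega x -> Omega y -> edist x y <= diam Omega.
Proof.
move=> Ox Oy; apply: ub_le_sup; last by exists (x, y).
have bnd i : exists M : R, forall z : 'rV[R]_d, Omega z -> `|z ord0 i| <= M.
  have : compact ((fun z : 'rV[R]_d => z ord0 i) @` Omega).
    apply: continuous_compact => //.
    by apply: continuous_subspaceT => z; exact: coord_continuous.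
  move=> /compact_bounded [M [_ Mb]].
  exists (M + 1) => z Oz; apply: (Mb (M + 1)); first by rewrite ltrDl.
  by exists z.
have [M Mb] := choice bnd.
exists (Num.sqrt (\sum_i (M i *+ 2) ^+ 2)) => _ [[u v] [/= Ou Ov] <-].
apply: ler_wsqrtr; apply: ler_sum => i _.
rewrite -real_normK ?num_real//.
rewrite lerXn2r ?nnegrE ?mulrn_wge0 ?(le_trans _ (Mb i u Ou))// !mxE.
by rewrite (le_trans (ler_normB _ _))// mulr2n lerD ?Mb.
Qed.

Lemma diam_gt0 x y : Omega x -> Omega y -> x != y -> 0 < diam Omega.
Proof.
by move=> Ox Oy xy; apply: lt_le_trans (edist_le_diam Ox Oy); exact: edist_gt0.
Qed.

End diameter.

End euclidean_distance.

(** * Measurability of the extended logarithm *)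

Section lne.
Context {R : realType}.

Lemma measurable_lne : measurable_fun setT (@lne R).
Proof.
apply: (measurability _ (ErealGenOInfty.measurableE R)).
move=> _ [_ [r ->] <-]; rewrite setTI.
rewrite (_ : _ @^-1` _ = [set x : \bar R | ((expR r)%:E < x)%E]).
  rewrite -[X in measurable X]setTI.
  exact: (@emeasurable_fun_o_infty _ _ R setT id).
apply/seteqP; split=> [[x| |]|[x| |]]//=; rewrite ?in_itv/= ?andbT ?ltry//.
- case: (leP x 0) => x0 //; rewrite ?andbT !lte_fin => rx.
  by rewrite -[ltRHS]lnK ?posrE// ltr_expR.
- rewrite !lte_fin => rx; have x0 := lt_trans (expR_gt0 r) rx.
  rewrite leNgt x0/= lte_fin.
  by rewrite -ltr_expR lnK.
Qed.

End lne.

Lemma big_pair_split (V : Type) (idx : V) (op : Monoid.com_law idx)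
    (I J : finType) (F : I * J -> V) :
  \big[op/idx]_ij F ij = \big[op/idx]_i \big[op/idx]_j F (i, j).
Proof. by rewrite pair_bigA; apply: eq_bigr => -[]. Qed.

(** * The Wasserstein distance through couplings *)

Section integral_on_piece.
Context {R : realType} d (T : measurableType d).

Lemma ge0_integral_carried_cst (mu : {measure set T -> \bar R}) (F : set T)
    (f : T -> \bar R) (c : R) :
  measurable F -> mu (~` F) = 0%E -> measurable_fun setT f ->
  (forall x, 0 <= f x)%E -> (forall x, F x -> f x = c%:E) ->
  (\int[mu]_x f x = c%:E * mu F)%E.
Proof.
move=> mF muF mf f0 fc.
rewrite (@ge0_negligible_integral _ _ _ mu setT (~` F))//;
  last exact: measurableC.
rewrite setTD setCK (eq_integral (cst c%:E)) ?integral_cst//.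
by move=> x /set_mem /fc.
Qed.

Lemma le_integral_carried (mu : {measure set T -> \bar R}) (F : set T)
    (f : T -> \bar R) (c : R) :
  measurable F -> mu (~` F) = 0%E -> measurable_fun setT f ->
  (forall x, 0 <= f x)%E -> (forall x, F x -> f x <= c%:E)%E ->
  (\int[mu]_x f x <= c%:E * mu F)%E.
Proof.
move=> mF muF mf f0 fc.
rewrite (@ge0_negligible_integral _ _ _ mu setT (~` F))//;
  last exact: measurableC.
rewrite setTD setCK -integral_cst//.
apply: ge0_le_integral => //; exact: measurable_funTS.
Qed.

End integral_on_piece.

Section wasserstein.
Context {R : realType} {d : nat}.
Local Notation E := (Rn R d).
Implicit Types (mu nu : {measure set E -> \bar R}).
Implicit Types (pi : probability (E * E)%type R).

Local Notation cost pi := (\int[pi]_z (edist z.1 z.2)%:E)%E.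

Let cost_ge0 pi : (0 <= cost pi)%E.
Proof. by apply: integral_ge0 => z _; rewrite lee_fin edist_ge0. Qed.

Lemma ereal_inf_cost_ge0 mu nu :
  (0 <= ereal_inf [set cost pi | pi in couplings mu nu])%E.
Proof. by apply: le_ereal_inf_tmp => _ [pi _ <-]; exact: cost_ge0. Qed.

Lemma W1_ge0 mu nu : 0 <= W1 mu nu.
Proof. by rewrite fine_ge0// ereal_inf_cost_ge0. Qed.

Lemma W1_le mu nu pi (c : R) : couplings mu nu pi -> (cost pi <= c%:E)%E ->
  W1 mu nu <= c.
Proof.
move=> Cpi pic; rewrite -lee_fin.
have infc : (ereal_inf [set cost p | p in couplings mu nu] <= c%:E)%E.
  by apply: le_trans pic; apply: ereal_inf_lbound; exists pi.
rewrite /W1 fineK// fin_numElt (lt_le_trans _ (ereal_inf_cost_ge0 _ _)) ?ltNy0//=.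
by rewrite (le_lt_trans infc) ?ltry.
Qed.

Lemma W1_approx mu nu (e : R) : 0 < e ->
  (exists2 pi, couplings mu nu pi & (cost pi < +oo)%E) ->
  exists2 pi, couplings mu nu pi & (cost pi <= (W1 mu nu + e)%:E)%E.
Proof.
move=> e0 [pi0 Cpi0 fpi0].
have Sfin : ereal_inf [set cost p | p in couplings mu nu] \is a fin_num.
  rewrite fin_numElt (lt_le_trans _ (ereal_inf_cost_ge0 _ _)) ?ltNy0//=.
  apply: le_lt_trans fpi0; apply: ereal_inf_lbound; by exists pi0.
have [_ [pi Cpi <-] lepi] := lb_ereal_inf_adherent e0 Sfin.
by exists pi => //; apply: ltW; rewrite EFinD /W1 fineK.
Qed.

Lemma couplings_prob_of_measure mu nu (P : {measure set (E * E) -> \bar R})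
    (P1 : P setT = 1%E) :
  (forall A, measurable A -> P (fst @^-1` A) = mu A /\ P (snd @^-1` A) = nu A) ->
  couplings mu nu (probability_of_measure P1).
Proof. by move=> h A mA; have [] := h A mA. Qed.

Let preimage_fst (A : set E) : measurable A ->
  measurable (fst @^-1` A : set (E * E)).
Proof. by move=> mA; rewrite -[X in measurable X]setTI; exact: measurable_fst. Qed.

Let preimage_snd (A : set E) : measurable A ->
  measurable (snd @^-1` A : set (E * E)).
Proof. by move=> mA; rewrite -[X in measurable X]setTI; exact: measurable_snd. Qed.

Lemma measurable_pair_cst (x : E) : measurable_fun setT (fun z : E => (x, z)).
Proof. by apply: measurable_fun_pair. Qed.

Let measurable_pair_snd (x : E) :
  measurable_fun setT (fun z : E * E => (x, z.2)).
Proof.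
apply: measurable_fun_pair => //; exact: measurable_snd.
Qed.

Let measurable_edist_from (x : E) :
  measurable_fun setT (fun z : E => (edist x z)%:E).
Proof.
exact: (@measurableT_comp _ _ _ _ _ _ (fun p : E * E => (edist p.1 p.2)%:E) _
  (fun z => (x, z)) measurable_eedist (measurable_pair_cst x)).
Qed.

Section atoms.
Context {I : finType} (X : I -> E) (X_inj : injective X).
Implicit Types (p q : I -> R) (w : I * I -> R).

(** The masses of a coupling of two measures carried by X, as a matrix. *)
Definition transport_plan w p q :=
  [/\ forall ij, 0 <= w ij, forall i, \sum_j w (i, j) = p i &
      forall j, \sum_i w (i, j) = q j].

Definition plan_cost w := \sum_ij w ij * edist (X ij.1) (X ij.2).

(** Makes the infimum that defines [W1] finite; the coupling is the product. *)
Lemma finite_cost_coupling (Omega : set E) (D : R) q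
    (b : {measure set E -> \bar R}) (c : probability E R) :
  (forall x y, Omega x -> Omega y -> edist x y <= D) ->
  measurable Omega -> (forall i, Omega (X i)) -> c Omega = 1%E ->
  prob_vec q -> atomic X q b ->
  exists2 pi, couplings b c pi & (cost pi < +oo)%E.
Proof.
move=> diamO mO OX cO [q0 q1] bq.
pose m i := image_measure c (measurable_pair_cst (X i)).
have mE i A : m i A = c ((fun z : E => (X i, z)) @^-1` A) by [].
pose P := mixture (fun i => NngNum (q0 i)) m.
have P1 : P setT = 1%E.
  rewrite /P mixtureE -q1 -sumEFin; apply: eq_bigr => i _.
  by rewrite mE preimage_setT probability_setT mule1.
exists (probability_of_measure P1).
  apply: couplings_prob_of_measure => A mA; split.
    transitivity (\sum_i (q i)%:E * \d_(X i) A)%E; last exact/esym/bq.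
    rewrite /P mixtureE; apply: eq_bigr => i _; rewrite mE -comp_preimage/=.
    congr (_ * _)%E; rewrite diracE; have [XA|XA] := boolP (X i \in A).
      rewrite (_ : _ @^-1` _ = setT) ?probability_setT//.
      by apply/seteqP; split => // z _; exact: set_mem.
    rewrite (_ : _ @^-1` _ = set0) ?measure0//.
    by apply/seteqP; split => // z zA; case/negP: XA; exact/mem_set.
  rewrite /P mixtureE (eq_bigr (fun i => (q i)%:E * c A)%E); last first.
    by move=> i _; rewrite mE -comp_preimage.
  by rewrite -ge0_sume_distrl ?sumEFin ?q1 ?mul1e// => i _; rewrite lee_fin.
rewrite (_ : integral _ _ _ = \int[P]_z (edist z.1 z.2)%:E)%E//.
rewrite ge0_integral_mixture; last 2 first.
- exact: measurable_eedist.
- by move=> z; rewrite lee_fin edist_ge0.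
apply: (@le_lt_trans _ _ (\sum_i (q i)%:E * D%:E)%E); last first.
  by rewrite (eq_bigr (fun i => (q i * D)%:E))// sumEFin ltry.
apply: lee_sum => i _; apply: lee_wpmul2l; first by rewrite lee_fin.
rewrite ge0_integral_image; last 2 first.
- exact: measurable_eedist.
- by move=> z; rewrite lee_fin edist_ge0.
rewrite -[leRHS]mule1 -cO; apply: le_integral_carried => //=.
- by rewrite probability_setC// cO subee.
- by move=> z; rewrite lee_fin edist_ge0.
- by move=> z Oz; rewrite lee_fin diamO.
Qed.

Section gluing.
Variables (p q : I -> R) (w : I * I -> R).
Variables (a : {measure set E -> \bar R}) (b c : probability E R).
Variables (pi : probability (E * E)%type R).
Hypothesis pq : prob_vec q.
Hypotheses (ap : atomic X p a) (bq : atomic X q b).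
Hypotheses (wpq : transport_plan w p q) (bcpi : couplings b c pi).

Let F j : set (E * E) := fst @^-1` [set X j].

Let mF j : measurable (F j).
Proof. by apply: preimage_fst; exact: measurable_singleton. Qed.

Let piF j : pi (F j) = (q j)%:E.
Proof.
have [] := bcpi (measurable_singleton (X j)); rewrite /pushforward => -> _.
exact: (atomic_mass (measurable_singleton (d := d)) _ X_inj bq).
Qed.

Let pi_pieces A : measurable A -> pi A = (\sum_j pi (A `&` F j))%E.
Proof.
move=> mA; apply: prob_carried_by_pieces => //.
  apply/trivIsetP => i j _ _ ij; rewrite -subset0 => x [/= xi xj].
  by case/eqP: ij; apply: X_inj; rewrite -xi.
have -> : \bigcup_i F i = fst @^-1` (range X).
  by rewrite -bigcup_imset1 preimage_bigcup.
have [] := bcpi (measurable_range (measurable_singleton (d := d)) X).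
rewrite /pushforward => -> _.
by rewrite (atomic_range (measurable_singleton (d := d)) bq) pq.2.
Qed.

Let r j : {measure set (E * E) -> \bar R} := mrestr pi (mF j).

Let rE j A : r j A = pi (A `&` F j). Proof. by []. Qed.

Let rT j : r j setT = (q j)%:E. Proof. by rewrite rE setTI piF. Qed.

Let r_fin j A : measurable A -> r j A \is a fin_num.
Proof.
by move=> mA; rewrite rE fin_num_measure//; exact: measurableI.
Qed.

Let r_le j A : measurable A -> (r j A <= (q j)%:E)%E.
Proof. by move=> mA; rewrite -rT le_measure// inE. Qed.

Let w_le ij : w ij <= q ij.2.
Proof.
case: wpq => w0 _ <-; case: ij => i j /=.
by rewrite (bigD1 i)//= lerDl sumr_ge0.
Qed.

Let wq_ge0 ij : 0 <= w ij / q ij.2.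
Proof. by rewrite divr_ge0 ?pq.1//; case: wpq. Qed.

Let wqK ij : w ij / q ij.2 * q ij.2 = w ij.
Proof.
have [q0|q0] := eqVneq (q ij.2) 0; last by rewrite divfK.
rewrite q0 mulr0; apply/esym/eqP; rewrite eq_le -{1}q0 w_le/=.
by case: wpq.
Qed.

(** w (i, j) / q j is the conditional probability of i given j. If q j = 0 it is
0 by convention, hence the condition on t. *)
Let sum_wq_scale (t : I -> R) : (forall j, q j = 0 -> t j = 0) ->
  \sum_ij w ij / q ij.2 * t ij.2 = \sum_j t j.
Proof.
move=> qt.
rewrite big_pair_split/= exchange_big/=.
apply: eq_bigr => j _; rewrite -mulr_suml -mulr_suml.
have -> : \sum_i w (i, j) = q j by case: wpq.
have [q0|q0] := eqVneq (q j) 0; first by rewrite qt// mulr0.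
by rewrite divff// mul1r.
Qed.

(** The mass at i is sent to z.2, where z follows pi conditioned on z.1 = X j. *)
Let m ij := image_measure (r ij.2) (measurable_pair_snd (X ij.1)).

Let mE ij A : m ij A = pi ((fun z : E * E => (X ij.1, z.2)) @^-1` A `&` F ij.2).
Proof. by []. Qed.

Let glued := mixture (fun ij => NngNum (wq_ge0 ij)) m.

Let glued_fst A : measurable A -> glued (fst @^-1` A) = a A.
Proof.
move=> mA; rewrite /glued mixtureE ap//.
rewrite (eq_bigr (fun ij => (w ij)%:E * \d_(X ij.1) A)%E); last first.
  move=> ij _; rewrite mE -comp_preimage /= diracE.
  have [XA|XA] := boolP (X ij.1 \in A).
    rewrite (_ : _ @^-1` _ = setT); last first.
      by apply/seteqP; split => // z _; exact: set_mem.
    by rewrite setTI piF mule1 -EFinM wqK.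
  rewrite (_ : _ @^-1` _ = set0) ?set0I ?measure0 ?mule0//.
  by apply/seteqP; split => // z zA; case/negP: XA; exact/mem_set.
rewrite big_pair_split/=.
apply: eq_bigr => i _; rewrite -ge0_sume_distrl ?sumEFin; last first.
  by move=> j _; rewrite lee_fin; case: wpq.
by case: wpq => _ ->.
Qed.

Let glued_snd A : measurable A -> glued (snd @^-1` A) = c A.
Proof.
move=> mA; rewrite /glued mixtureE.
have [_ <-] := bcpi mA; rewrite /pushforward (pi_pieces (preimage_snd mA)).
have mA' := preimage_snd mA.
rewrite (eq_bigr (fun ij =>
  (w ij / q ij.2 * fine (r ij.2 (snd @^-1` A)))%:E)); last first.
  by move=> ij _; rewrite [in RHS]EFinM [in RHS]fineK ?r_fin.
rewrite sumEFin (sum_wq_scale (t := fun j => fine (r j (snd @^-1` A)))).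
  by rewrite -sumEFin; apply: eq_bigr => j _; rewrite fineK ?r_fin.
move=> j qj; apply/eqP; rewrite -eqe fineK ?r_fin// eq_le measure_ge0 andbT.
by rewrite -qj r_le.
Qed.

Let glued1 : glued setT = 1%E.
Proof. by rewrite -(preimage_setT snd) glued_snd// probability_setT. Qed.

Let integral_pieces (f : E * E -> \bar R) : measurable_fun setT f ->
  (forall z, 0 <= f z)%E -> (\int[pi]_z f z = \sum_j \int[r j]_z f z)%E.
Proof.
move=> mf f0.
rewrite (@eq_measure_integral _ _ _ setT (mixture (fun=> 1%:nng) r)); last first.
  move=> A mA _; rewrite mixtureE.
  transitivity (\sum_j pi (A `&` F j))%E; first exact: pi_pieces.
  by apply: eq_bigr => j _; rewrite mul1e.
by rewrite ge0_integral_mixture//; apply: eq_bigr => j _; rewrite mul1e.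
Qed.

(** Gluing of a transport plan from a to b with a coupling pi of b and c. As b
is atomic, conditioning pi on its first marginal is restricting it to the
slices F j. *)
Lemma W1_le_glued (s : R) : (cost pi <= s%:E)%E ->
  W1 a c <= plan_cost w + s.
Proof.
move=> pis.
apply: (W1_le (pi := probability_of_measure glued1)).
  by apply: couplings_prob_of_measure => A mA; rewrite glued_fst// glued_snd.
rewrite (_ : integral _ _ _ = \int[glued]_z (edist z.1 z.2)%:E)%E//.
have e0 (z : E * E) : (0 <= (edist z.1 z.2)%:E)%E by rewrite lee_fin edist_ge0.
rewrite ge0_integral_mixture//; last exact: measurable_eedist.
pose C j := (\int[r j]_z (edist z.1 z.2)%:E)%E.
have C0 j : (0 <= C j)%E by apply: integral_ge0 => z _; exact: e0.
have sumC : (\sum_j C j <= s%:E)%E.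
  by rewrite /C -integral_pieces//; exact: measurable_eedist.
have Cfin j : C j \is a fin_num.
  rewrite ge0_fin_numE// (le_lt_trans _ (ltry s))//.
  by apply: le_trans sumC; rewrite (bigD1 j)//= leeDl// sume_ge0.
have step ij : (\int[m ij]_z (edist z.1 z.2)%:E <=
    (edist (X ij.1) (X ij.2) * q ij.2)%:E + C ij.2)%E.
  rewrite ge0_integral_image//; last exact: measurable_eedist.
  have m1 : measurable_fun setT (fun z : E * E => (edist (X ij.1) z.1)%:E).
    by apply: (measurableT_comp (measurable_edist_from _)); exact: measurable_fst.
  have m2 : measurable_fun setT (fun z : E * E => (edist (X ij.1) z.2)%:E).
    by apply: (measurableT_comp (measurable_edist_from _)); exact: measurable_snd.
  apply: (@le_trans _ _ (\int[r ij.2]_z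
      ((edist (X ij.1) z.1)%:E + (edist z.1 z.2)%:E))%E).
    apply: ge0_le_integral => //.
    - by move=> z _; rewrite lee_fin edist_ge0.
    - by apply: emeasurable_funD => //; exact: measurable_eedist.
    - by move=> z _; rewrite -EFinD lee_fin edist_triangle.
  have d0 z : (0 <= (edist (X ij.1) z)%:E)%E by rewrite lee_fin edist_ge0.
  rewrite (ge0_integralD _ measurableT (fun z _ => d0 z.1) m1 (fun z _ => e0 z)
    measurable_eedist).
  rewrite leeD2r//.
  rewrite (@ge0_integral_carried_cst _ _ _ (r ij.2) (F ij.2) _
    (edist (X ij.1) (X ij.2)))//.
  - by rewrite rE setIid piF.
  - by rewrite rE setICl measure0.
  - by move=> z ->.
apply: (@le_trans _ _ (\sum_ij (w ij / q ij.2)%:E *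
    ((edist (X ij.1) (X ij.2) * q ij.2)%:E + C ij.2)%E)%E).
  by apply: lee_sum => ij _; apply: lee_wpmul2l; rewrite ?lee_fin ?wq_ge0.
rewrite (eq_bigr (fun ij => (w ij * edist (X ij.1) (X ij.2) +
    w ij / q ij.2 * fine (C ij.2))%:E)); last first.
  move=> ij _; rewrite -[C _]fineK// -EFinD -EFinM mulrDr; congr (_ + _)%:E.
  by rewrite mulrCA mulrC wqK mulrC.
rewrite sumEFin big_split/= (sum_wq_scale (t := fun j => fine (C j))).
  rewrite lee_fin lerD2l -lee_fin -sumEFin (le_trans _ sumC)// lee_sum// => j _.
  by rewrite fineK.
move=> j qj; apply/eqP; rewrite -eqe fineK// eq_le C0 andbT.
have := @le_integral_carried _ _ _ (r j) set0
  (fun z : E * E => (edist z.1 z.2)%:E) 0.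
rewrite mul0e; apply => //.
- by rewrite setC0 rT qj.
- exact: measurable_eedist.
Qed.

End gluing.

(** Both marginals being carried by X, the coupling is carried by the
finite set X x X. *)
Lemma plan_of_coupling p q (a b : {measure set E -> \bar R})
    (pi : probability (E * E)%type R) :
  prob_vec p -> prob_vec q -> atomic X p a -> atomic X q b ->
  couplings a b pi ->
  exists2 w, transport_plan w p q & (plan_cost w)%:E = cost pi.
Proof.
move=> [p0 p1] [q0 q1] ap bq abpi.
have mptE := measurable_singleton (R := R) (d := d).
have mpt (z : E * E) : measurable [set z].
  rewrite (_ : [set z] = [set z.1] `*` [set z.2]); first exact: measurableX.
  by case: z => x y; apply/seteqP; split => [_ ->//|[u v] [/= -> ->]].
pose Y ij := (X ij.1, X ij.2).
have Y_inj : injective Y by move=> [i j] [i' j'] [/X_inj -> /X_inj ->].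
have rangeY : range Y = fst @^-1` range X `&` snd @^-1` range X.
  apply/seteqP; split=> [_ [ij _ <-]|[x y] [[i _ /= <-] [j _ /= <-]]].
    by split => /=; [exists ij.1|exists ij.2].
  by exists (i, j).
have mX : measurable (range X) by exact: measurable_range.
have piY : pi (range Y) = 1%E.
  have [pi1 pi2] := abpi _ mX; move: pi1 pi2; rewrite /pushforward.
  rewrite (atomic_range mptE ap) (atomic_range mptE bq) p1 q1 => pi1 pi2.
  have m1 := preimage_fst mX; have m2 := preimage_snd mX.
  rewrite rangeY -[X in pi X]setCK probability_setC; last first.
    by apply: measurableC; exact: measurableI.
  have pi1C : pi (~` (fst @^-1` range X)) = 0%E.
    by rewrite probability_setC// pi1 subee.
  have pi2C : pi (~` (snd @^-1` range X)) = 0%E.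
    by rewrite probability_setC// pi2 subee.
  have : (pi (~` (fst @^-1` range X) `|` ~` (snd @^-1` range X)) <=
      pi (~` (fst @^-1` range X)) + pi (~` (snd @^-1` range X)))%E.
    by apply: measureU2; exact: measurableC.
  rewrite pi1C pi2C adde0 -setCI measure_le0 => /eqP ->.
  by rewrite sube0.
have at_pi := prob_range_atomic mpt Y_inj piY.
have [w0 _] := prob_vec_atomic mpt Y_inj piY.
set w := (fun ij => fine _) in at_pi w0.
exists w.
  split=> // [i|j].
  - apply: EFin_inj; rewrite -(atomic_mass mptE i X_inj ap).
    have [<- _] := abpi _ (mptE (X i)).
    rewrite /pushforward at_pi; last exact: preimage_fst.
    rewrite big_pair_split/=.
    rewrite [RHS](bigD1 i)//= [X in (_ + X)%E]big1 ?adde0; last first.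
      move=> i' ii'; rewrite big1// => j _; rewrite diracE memNset ?mule0//=.
      by move/X_inj/eqP; rewrite (negbTE ii').
    by rewrite -sumEFin; apply: eq_bigr => j _; rewrite diracE mem_set ?mule1.
  - apply: EFin_inj; rewrite -(atomic_mass mptE j X_inj bq).
    have [_ <-] := abpi _ (mptE (X j)).
    rewrite /pushforward at_pi; last exact: preimage_snd.
    rewrite big_pair_split/=.
    rewrite [RHS]exchange_big [RHS](bigD1 j)//= [X in (_ + X)%E]big1 ?adde0;
      last first.
      move=> j' jj'; rewrite big1// => i _; rewrite diracE memNset ?mule0//=.
      by move/X_inj/eqP; rewrite (negbTE jj').
    by rewrite -sumEFin; apply: eq_bigr => i _; rewrite diracE mem_set ?mule1.
rewrite (ge0_integral_atomic w0 at_pi)//; last 2 first.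
- exact: measurable_eedist.
- by move=> z _; rewrite lee_fin edist_ge0.
by rewrite -sumEFin; apply: eq_bigr => ij _; rewrite EFinM.
Qed.

End atoms.
End wasserstein.

(** * Wasserstein distance on a mesh *)

Section wasserstein_on_mesh.
Context {R : realType} {d : nat}.
Local Notation E := (Rn R d).
Variables (Omega : set E).
Hypothesis Omega_compact : compact (Omega : set 'rV[R]_d).
Context {I : finType} (X : I -> E).
Hypotheses (X_inj : injective X) (X_Omega : forall i, Omega (X i)).
Implicit Types (p q : I -> R) (w : I * I -> R).
Implicit Types (a : {measure set E -> \bar R}) (b c : probability E R).

Let D := diam (Omega : set 'rV[R]_d).

Let measurable_Omega : measurable (Omega : set E).
Proof. exact: compact_measurable_rV. Qed.

Let edist_le x y : Omega x -> Omega y -> edist x y <= D.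
Proof. exact: edist_le_diam. Qed.

Lemma atomic_prob_on q b : prob_vec q -> atomic X q b -> prob_on Omega b.
Proof.
move=> [q0 q1] bq; rewrite /prob_on /mkset.
have b1 : (b Omega <= 1)%E by apply: probability_le1; exact: measurable_Omega.
apply/eqP; rewrite eq_le b1 /=.
rewrite -[X in (X <= _)%E](_ : b (range X) = 1%E); last first.
  by rewrite (atomic_range (measurable_singleton (d := d)) bq) q1.
apply: le_measure; rewrite ?inE//.
  exact: (measurable_range (measurable_singleton (d := d))).

by move=> _ [i _ <-].
Qed.

Lemma W1_plan_approx p q a b (e : R) : 0 < e ->
  prob_vec p -> prob_vec q -> atomic X p a -> atomic X q b ->
  exists2 w, transport_plan w p q & plan_cost X w <= W1 a b + e.
Proof.
move=> e0 pp pq ap bq.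
have [pi abpi pile] := W1_approx e0 (finite_cost_coupling edist_le
  measurable_Omega X_Omega (atomic_prob_on pq bq) pp ap).
have [w wpq wpi] := plan_of_coupling X_inj pp pq ap bq abpi.
by exists w => //; rewrite -lee_fin wpi.
Qed.

Lemma W1_triangle p q a b c : prob_vec p -> prob_vec q ->
  atomic X p a -> atomic X q b -> prob_on Omega c ->
  W1 a c <= W1 a b + W1 b c.
Proof.
move=> pp pq ap bq cO; apply/ler_addgt0Pr => e e0.
have e20 : 0 < e / 2 by rewrite divr_gt0.
have [w wpq wle] := W1_plan_approx e20 pp pq ap bq.
have [pi bcpi pile] := W1_approx e20 (finite_cost_coupling edist_le
  measurable_Omega X_Omega cO pq bq).
have := W1_le_glued X_inj pq ap bq wpq bcpi pile; lra.
Qed.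

(** Gluing with the diagonal coupling of b, which costs nothing. *)
Lemma W1_le_plan_cost p q a b w : prob_vec p -> prob_vec q ->
  atomic X p a -> atomic X q b -> transport_plan w p q ->
  W1 a b <= plan_cost X w.
Proof.
move=> pp pq ap bq wpq.
have mdiag : measurable_fun setT (fun x : E => (x, x)).
  exact: measurable_fun_pair.
rewrite -[leRHS]addr0.
apply: (W1_le_glued (pi := image_probability b mdiag) X_inj pq ap bq wpq).
  by move=> A mA; split.
rewrite (_ : integral _ _ _ =
  \int[image_measure b mdiag]_z (edist z.1 z.2)%:E)%E//.
rewrite ge0_integral_image; last 2 first.
- exact: measurable_eedist.
- by move=> z; rewrite lee_fin edist_ge0.
by rewrite integral0_eq// => x _ /=; rewrite edistxx.
Qed.

(** Mass that does not stay in place travels at least delta. *)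
Lemma l1_dist_le_W1 (delta : R) p q a b : prob_vec p -> prob_vec q ->
  atomic X p a -> atomic X q b -> 0 <= delta ->
  (forall i j, i != j -> delta <= edist (X i) (X j)) ->
  delta / 2 * l1_dist p q <= W1 a b.
Proof.
move=> pp pq ap bq delta0 deltaX; apply/ler_addgt0Pr => e e0.
have [w [w0 wp wq] wle] := W1_plan_approx e0 pp pq ap bq.
apply: le_trans wle.
pose S i := \sum_(j | j != i) w (i, j); pose S' i := \sum_(j | j != i) w (j, i).
have SE : \sum_i S i = \sum_i S' i.
  rewrite /S /S' (exchange_big_dep xpredT)//=; apply: eq_bigr => i _.
  by apply: eq_bigl => j; rewrite eq_sym.
have pqS i : `|p i - q i| <= S i + S' i.
  have S0 : 0 <= S i by exact: sumr_ge0.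
  have S'0 : 0 <= S' i by exact: sumr_ge0.
  have pS : p i = w (i, i) + S i by rewrite -wp (bigD1 i).
  have qS : q i = w (i, i) + S' i by rewrite -wq (bigD1 i).
  by rewrite pS qS ler_norml; lra.
have : l1_dist p q <= \sum_i S i + \sum_i S' i by rewrite -big_split ler_sum.
rewrite -SE => l1S.
apply: (@le_trans _ _ (delta * \sum_i S i)); first by nra.
rewrite /plan_cost big_pair_split/= mulr_sumr ler_sum// => i _.
rewrite [leRHS](bigD1 i)//= edistxx mulr0 add0r mulr_sumr ler_sum// => j ji.
by rewrite mulrC ler_wpM2l// deltaX// eq_sym.
Qed.

(** Keep the common mass [mn] in place and transport the excesses u and v of p
and q, of total mass T = |p - q|_1 / 2, independently. *)
Lemma W1_le_l1_dist p q a b : prob_vec p -> prob_vec q ->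
  atomic X p a -> atomic X q b -> W1 a b <= D / 2 * l1_dist p q.
Proof.
move=> pp pq ap bq.
pose mn i := Num.min (p i) (q i).
pose u i := p i - mn i; pose v i := q i - mn i.
have u0 i : 0 <= u i by rewrite subr_ge0 ge_min lexx.
have v0 i : 0 <= v i by rewrite subr_ge0 ge_min lexx orbT.
pose T := \sum_i u i.
have vT : \sum_i v i = T by rewrite /T /u /v !sumrB pp.2 pq.2.
have T0 : 0 <= T by exact: sumr_ge0.
have l1T : l1_dist p q = 2 * T.
  rewrite mulr_natl mulr2n -[X in _ + X]vT -big_split; apply: eq_bigr => i _ /=.
  by rewrite /u /v /mn; case: leP => h; [rewrite ler0_norm|rewrite ger0_norm]; lra.
have uT i : u i * T / T = u i.
  have [T_eq0|TN0] := eqVneq T 0; last by rewrite mulfK.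
  rewrite T_eq0 mulr0 mul0r; apply/esym.
  exact: (psumr_eq0P (P := xpredT) (fun i _ => u0 i)).
have vTK i : T * v i / T = v i.
  have [T_eq0|TN0] := eqVneq T 0; last by rewrite mulrAC divff// mul1r.
  rewrite T_eq0 !mul0r; apply/esym; rewrite -vT in T_eq0.
  exact: (psumr_eq0P (P := xpredT) (fun i _ => v0 i)).
pose w (ij : I * I) := (if ij.1 == ij.2 then mn ij.1 else 0) + u ij.1 * v ij.2 / T.
have wpq : transport_plan w p q.
  split=> [[i j]|i|j]; rewrite /w/=.
  - rewrite addr_ge0 ?divr_ge0 ?mulr_ge0//; case: ifP => // _.
    by rewrite /mn le_min pp.1 pq.1.
  - rewrite big_split/= -big_mkcond/= (big_pred1 i); last first.
      by move=> j; rewrite /= eq_sym.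
    by rewrite -mulr_suml -mulr_sumr vT uT /u addrC subrK.
  - rewrite big_split/= -big_mkcond/= (big_pred1 j)//.
    by rewrite -!mulr_suml -/T vTK /v addrC subrK.
apply: le_trans (W1_le_plan_cost pp pq ap bq wpq) _.
have -> : D / 2 * l1_dist p q = D * T by rewrite l1T; lra.
apply: (@le_trans _ _ (\sum_ij u ij.1 * v ij.2 / T * D)).
  rewrite ler_sum// => -[i j] _; rewrite /w/=.
  case: eqVneq => [->|_]; last first.
    by rewrite add0r ler_wpM2l ?edist_le ?divr_ge0 ?mulr_ge0.
  rewrite edistxx mulr0 !mulr_ge0 ?invr_ge0//.
  by apply: le_trans (edist_le (X_Omega j) (X_Omega j)); exact: edist_ge0.
rewrite -mulr_suml mulrC big_pair_split/= le_eqVlt; apply/orP; left; apply/eqP.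
congr (_ * _); apply: eq_bigr => i _.
by rewrite -mulr_suml -mulr_sumr vT uT.
Qed.

Section averages.
Variables (mu : nat -> probability E R) (p : nat -> I -> R).
Hypothesis pp : forall k, prob_vec (p k).
Hypothesis mup : forall k, atomic X (p k) (mu k).
Variables (K : nat).
Hypothesis K_gt0 : (0 < K)%N.

Definition average_vec i := K%:R^-1 * \sum_(k < K) p k i.

Let K0 : 0 < K%:R :> R. Proof. by rewrite ltr0n. Qed.

Lemma prob_average_vec : prob_vec average_vec.
Proof.
split=> [i|]; rewrite /average_vec.
  by rewrite mulr_ge0 ?invr_ge0 ?ler0n// sumr_ge0// => k _; case: (pp k).
rewrite -mulr_sumr exchange_big/= (eq_bigr (fun=> 1)).
  by rewrite sumr_const card_ord mulVf ?gt_eqF.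
by move=> k _; case: (pp k).
Qed.

Lemma atomic_average : atomic X average_vec (average mu K).
Proof.
move=> A mA; rewrite /average /= /mscale /= /msum.
transitivity ((K%:R^-1)%:E * \sum_(k < K) (\sum_i p k i * \1_A (X i))%:E)%E.
  congr (_ * _)%E; apply: eq_bigr => k _.
  transitivity (\sum_i (p k i)%:E * \d_(X i) A)%E; first exact: mup.
  by rewrite -sumEFin; apply: eq_bigr => i _; rewrite EFinM.
rewrite sumEFin -EFinM exchange_big/= mulr_sumr -sumEFin; apply: eq_bigr => i _.
by rewrite -mulr_suml mulrA EFinM.
Qed.

(** Convexity of W1: averages of almost optimal plans are plans between the
averages. *)
Lemma W1_average_le q b : prob_vec q -> atomic X q b ->
  W1 (average mu K) b <= K%:R^-1 * \sum_(k < K) W1 (mu k) b.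
Proof.
move=> pq bq; apply/ler_addgt0Pr => e e0.
have /choice[w wP] : forall k, exists w, transport_plan w (p k) q /\
    plan_cost X w <= W1 (mu k) b + e.
  by move=> k; have [w] := W1_plan_approx e0 (pp k) pq (mup k) bq; exists w.
pose wK ij := K%:R^-1 * \sum_(k < K) w k ij.
have wKP : transport_plan wK average_vec q.
  split=> [ij|i|j]; rewrite /wK.
  - rewrite mulr_ge0 ?invr_ge0 ?ler0n// sumr_ge0// => k _.
    by have [[w0 _ _] _] := wP k.
  - rewrite -mulr_sumr exchange_big/=; congr (_ * _); apply: eq_bigr => k _.
    by have [[_ wp _] _] := wP k.
  - rewrite -mulr_sumr exchange_big/= (eq_bigr (fun=> q j)).
      rewrite sumr_const card_ord -[q j *+ K]mulr_natr mulrCA.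
      by rewrite mulVf ?mulr1 ?gt_eqF.
    by move=> k _; have [[_ _ wq] _] := wP k.
apply: le_trans (W1_le_plan_cost prob_average_vec pq atomic_average bq wKP) _.
have -> : plan_cost X wK = K%:R^-1 * \sum_(k < K) plan_cost X (w k).
  rewrite /plan_cost exchange_big/= mulr_sumr; apply: eq_bigr => ij _.
  by rewrite -mulr_suml mulrA.
have -> : e = K%:R^-1 * \sum_(k < K) e.
  by rewrite sumr_const card_ord -[e *+ K]mulr_natr mulrCA mulVf ?mulr1 ?gt_eqF.
rewrite -mulrDr -big_split ler_wpM2l ?invr_ge0 ?ler0n// ler_sum// => k _.
by have [] := wP k.
Qed.

End averages.

End wasserstein_on_mesh.

(** * Divergence and pairings of atomic measures *)

Section atomic_functionals.
Local Open Scope charge_scope.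
Context {R : realType} {d : nat}.
Local Notation E := (Rn R d).
Context {I : finType} (X : I -> E) (X_inj : injective X).
Implicit Types (p q : I -> R).

Let mpt := measurable_singleton (R := R) (d := d).

(** A density is determined at every atom of the reference measure. *)
Lemma KL_atomic p q (eta mu : probability E R) :
  (forall i, 0 <= p i) -> (forall i, 0 < q i) ->
  atomic X p eta -> atomic X q mu -> KL eta mu = (rel_entropy p q)%:E.
Proof.
move=> p0 q0 etap muq.
have dom : eta `<< mu.
  apply/null_content_dominatesP => A mA muA.
  have {}muA : mu A = 0%E by [].
  have XA i : X i \notin A.
    apply/negP => XiA; have : ((q i)%:E <= mu A)%E.
      rewrite muq// (bigD1 i)//= diracE XiA mule1 leeDl// sume_ge0// => j _.
      by rewrite mule_ge0 ?lee_fin ?(ltW (q0 j)).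
    by rewrite muA lee_fin leNgt q0.
  transitivity (\sum_i (p i)%:E * \d_(X i) A)%E; first exact: etap.
  by rewrite big1// => i _; rewrite diracE (negbTE (XA i)) mule0.
rewrite /KL asboolT//.
set f := 'd _ '/d _.
have fX i : f (X i) = (p i / q i)%:E.
  have : (p i)%:E = (\int[mu]_(x in [set X i]) f x)%E.
    rewrite -(atomic_mass mpt i X_inj etap).
    exact: (@Radon_Nikodym_integral _ _ _ (charge_of_finite_measure eta)).
  rewrite (eq_integral (cst (f (X i)))); last by move=> x /set_mem ->.
  rewrite integral_cst//.
  rewrite (_ : (_ * _)%E = f (X i) * (q i)%:E)%E; last first.
    by congr (_ * _)%E; exact: (atomic_mass mpt i X_inj muq).
  case: (f (X i)) => [r| |].
  - by rewrite -EFinM => -[->]; rewrite mulfK// gt_eqF.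
  - by rewrite gt0_mulye// lte_fin.
  - by rewrite gt0_mulNye// lte_fin.
apply: (integral_atomic (g := fun i => ln (p i / q i)) p0 etap) => //.
- apply: (measurableT_comp measurable_lne).
  exact: (measurable_int _ (Radon_Nikodym_integrable _)).
- move=> i pi0; rewrite fX lne_EFin// divr_gt0// lt_neqAle eq_sym pi0.
  exact: p0.
Qed.

Section pairings.
Variables (Omega : set E).
Hypothesis mOmega : measurable Omega.

Lemma pairing_atomic p q (rho sigma : probability E R) (f : 'rV[R]_d -> R) :
  (forall i, Omega (X i)) -> measurable_fun Omega f ->
  (forall i, 0 <= p i) -> (forall i, 0 <= q i) ->
  atomic X p rho -> atomic X q sigma ->
  pairing Omega f rho sigma = \sum_i f (X i) * (p i - q i).
Proof.
move=> OX mf p0 q0 rp sq.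
have h r (tau : probability E R) : (forall i, 0 <= r i) -> atomic X r tau ->
    \int[tau]_(x in Omega) f x = \sum_i r i * f (X i).
  move=> r0 taur; rewrite /Rintegral.
  rewrite (integral_atomic (g := fun i => f (X i)) r0 taur)//.
  exact/measurable_EFinP.
rewrite /pairing (h p)// (h q)// -sumrB; apply: eq_bigr => i _.
by rewrite mulrBr ![f _ * _]mulrC.
Qed.

End pairings.

End atomic_functionals.

(** * Integrals against general probability measures *)

Section general_measures.
Context {R : realType} {d : nat}.
Local Notation E := (Rn R d).
Variables (Omega : set E).
Hypotheses (mOmega : measurable Omega).
Implicit Types (f : 'rV[R]_d -> R) (rho sigma tau : probability E R).

Lemma bounded_integrable rho f (M : R) : measurable_fun Omega f ->
  (forall x, Omega x -> `|f x| <= M) -> rho.-integrable Omega (EFin \o f).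
Proof.
move=> mf fM; apply: measurable_bounded_integrable => //.
  by apply: le_lt_trans (probability_le1 _ _) (ltry _).
exists M; split; first exact: num_real.
by move=> y My x Ox; apply: le_trans (fM x Ox) (ltW My).
Qed.

Lemma pairingB rho sigma f g :
  rho.-integrable Omega (EFin \o f) -> rho.-integrable Omega (EFin \o g) ->
  sigma.-integrable Omega (EFin \o f) -> sigma.-integrable Omega (EFin \o g) ->
  pairing Omega (fun x => f x - g x) rho sigma =
  pairing Omega f rho sigma - pairing Omega g rho sigma.
Proof. by move=> *; rewrite /pairing !RintegralB//; lra. Qed.

(** Moving mass by Q changes the integral of f by the mean of f o Q - f. *)
Lemma pairing_image_le (Q : E -> E) (mQ : measurable_fun setT Q) tau f (M e : R) :
  measurable_fun Omega f -> (forall x, Omega x -> `|f x| <= M) ->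
  (forall x, Omega x -> f (Q x) - f x <= e) -> tau Omega = 1%E ->
  (forall x, Omega (Q x)) ->
  pairing Omega f (image_probability tau mQ) tau <= e.
Proof.
move=> mf fM fe tau1 QT.
pose g := f \_ Omega.
have mg : measurable_fun setT g by exact/(measurable_restrictT _ _).1.
have gM x : `|g x| <= `|M|.
  rewrite /g patchE; case: ifPn => [/set_mem Ox|_]; last by rewrite normr0.
  by apply: le_trans (fM x Ox) (ler_norm _).
have mgQ : measurable_fun setT (g \o Q) by exact: measurableT_comp.
have intgQ : tau.-integrable setT (EFin \o (g \o Q)).
  apply: measurable_bounded_integrable => //.
    by apply: le_lt_trans (probability_le1 _ _) (ltry _).
  exists `|M|; split; first exact: num_real.
  by move=> y My x _; apply: le_trans (gM _) (ltW My).
have fQE : f \o Q = g \o Q by apply/funext => x /=; rewrite /g patchE mem_set.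
have QOT : Q @^-1` Omega = setT by apply/seteqP; split=> // x _; exact: QT.
have tauC : tau (~` Omega) = 0%E by rewrite probability_setC// tau1 subee.
have intfQ : \int[image_probability tau mQ]_(x in Omega) f x =
    \int[tau]_(x in Omega) f (Q x).
  rewrite /Rintegral; congr fine.
  rewrite (eq_integral (EFin \o g)); last first.
    by move=> x xO; rewrite /= /g patchE xO.
  rewrite (_ : integral _ _ _ =
    \int[pushforward tau Q]_(x in Omega) (EFin \o g) x)%E//.
  rewrite integral_pushforward//; last 2 first.
  - exact/measurable_EFinP.
  - by rewrite QOT.
  rewrite QOT (@negligible_integral _ _ _ tau _ _ _
    (measurableC mOmega) measurableT intgQ tauC).
  rewrite setTD setCK; apply: eq_integral => x _ /=.
  by rewrite -[f (Q x)]/((f \o Q) x) fQE.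
have int1 : tau.-integrable Omega (EFin \o (f \o Q)).
  by rewrite fQE; apply: integrableS intgQ.
have int2 := bounded_integrable tau mf fM.
rewrite /pairing intfQ -RintegralB//.
have -> : e = \int[tau]_(x in Omega) e.
  rewrite Rintegral_cst// (_ : fine _ = 1) ?mulr1//.
  exact: (congr1 fine tau1).
apply: le_Rintegral => //.
- rewrite (_ : EFin \o _ = (EFin \o (f \o Q)) \- (EFin \o f))%E//.
  exact: integrableB.
- by apply: (@bounded_integrable _ _ `|e|) => // x _.
Qed.

End general_measures.

(** * Mirror-Prox on a mesh *)

Section mirror_prox.
Context {R : realType} {d : nat}.
Local Notation E := (Rn R d).
Variable Omega : set 'rV[R]_d.
Hypothesis Omega_compact : compact Omega.
Variable J : probability E R -> 'rV[R]_d -> R.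
Hypothesis J_cont : forall mu, prob_on Omega mu ->
  {within Omega, continuous (J mu)}.
Variable Lm : R.
Hypothesis Lm_gt0 : 0 < Lm.
Hypothesis J_lip : forall mu nu, prob_on Omega mu -> prob_on Omega nu ->
  sup_norm Omega (fun x => J mu x - J nu x) <= Lm * W1 mu nu.
Variable alpha : R.
Hypothesis alpha_gt0 : 0 < alpha.
Hypothesis J_mono : forall rho sigma,
  prob_on Omega rho -> prob_on Omega sigma ->
  alpha * W1 rho sigma ^+ 2 <=
    pairing Omega (fun x => J rho x - J sigma x) rho sigma.
Variable Lx : R.
Hypothesis Lx_gt0 : 0 < Lx.
Hypothesis J_lipx : forall rho x y, prob_on Omega rho -> Omega x -> Omega y ->
  `|J rho x - J rho y| <= Lx * edist x y.

Local Notation D := (diam Omega).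

Let mOmega : measurable (Omega : set E).
Proof. exact: compact_measurable_rV. Qed.

Lemma J_measurable mu : prob_on Omega mu ->
  measurable_fun (Omega : set E) (J mu).
Proof.
by move=> muO; apply: within_continuous_measurable => //; exact: J_cont.
Qed.

Lemma J_bounded mu : prob_on Omega mu ->
  exists M : R, forall x, Omega x -> `|J mu x| <= M.
Proof.
move=> muO; have [[x0 Ox0]|O0] := pselect (Omega !=set0); last first.
  by exists 0 => x Ox; exfalso; apply: O0; exists x.
exists (`|J mu x0| + Lx * D) => x Ox.
rewrite -[J mu x](subrK (J mu x0)) (le_trans (ler_normD _ _))// addrC lerD2l.
rewrite (le_trans (J_lipx muO Ox Ox0))// ler_wpM2l ?(ltW Lx_gt0)//.
exact: edist_le_diam.
Qed.

Lemma J_integrable mu (rho : probability E R) : prob_on Omega mu ->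
  rho.-integrable (Omega : set E) (EFin \o J mu).
Proof.
move=> muO; have [M JM] := J_bounded muO.
exact: (bounded_integrable mOmega rho (J_measurable muO) JM).
Qed.

(** The Lipschitz bound in x makes J bounded on Omega, so that [sup_norm] is
a true supremum. *)
Lemma J_diff_le mu nu x : prob_on Omega mu -> prob_on Omega nu -> Omega x ->
  `|J mu x - J nu x| <= Lm * W1 mu nu.
Proof.
move=> muO nuO Ox; apply: le_trans (J_lip muO nuO).
apply: ub_le_sup; last by exists x.
have [M1 JM1] := J_bounded muO; have [M2 JM2] := J_bounded nuO.
exists (M1 + M2) => _ [y Oy <-].
by rewrite (le_trans (ler_normB _ _))// lerD ?JM1 ?JM2.
Qed.

Section mesh.
Variables (N : nat) (X : 'I_N -> E).
Local Notation I := 'I_N.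
Hypotheses (X_inj : injective X) (X_Omega : range X `<=` Omega).

Let XO i : Omega (X i). Proof. by apply: X_Omega; exists i. Qed.

Let mpt := measurable_singleton (R := R) (d := d).

Definition mass_vec (mu : probability E R) (i : I) : R := mass mu (X i).

Lemma mass_vec_atomic mu : prob_on (range X) mu -> atomic X (mass_vec mu) mu.
Proof. by move=> muX; exact: prob_range_atomic. Qed.

Lemma prob_mass_vec mu : prob_on (range X) mu -> prob_vec (mass_vec mu).
Proof. by move=> muX; exact: prob_vec_atomic. Qed.

Lemma mesh_prob_on mu : prob_on (range X) mu -> prob_on Omega mu.
Proof.
move=> muX.
exact: (atomic_prob_on Omega_compact XO (prob_mass_vec muX)
  (mass_vec_atomic muX)).
Qed.

Lemma pairing_mesh mu nu f : measurable_fun (Omega : set E) f ->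
  prob_on (range X) mu -> prob_on (range X) nu ->
  pairing Omega f mu nu = \sum_i f (X i) * (mass_vec mu i - mass_vec nu i).
Proof.
move=> mf muX nuX.
apply: (pairing_atomic mOmega) => //;
  by [case: (prob_mass_vec muX)|case: (prob_mass_vec nuX)|exact: mass_vec_atomic].
Qed.

Variable muh : probability E R.
Hypothesis muh_VI : solves_VI Omega (prob_on (range X)) J muh.

Let muhX : prob_on (range X) muh. Proof. by case: muh_VI. Qed.
Let muhO : prob_on Omega muh. Proof. exact: mesh_prob_on. Qed.

(** Strong monotonicity bounds alpha W1(muh, mustar)^2 by the pairing of
J muh - J mustar with muh - mustar. The J mustar part has the right sign as muh
competes in the continuous problem; the J muh part is split through the image
of mustar by Q, which competes in the discrete problem. *)
Lemma W1_equilibria (mustar : probability E R) (h : R) (Q : E -> E) :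
  measurable_fun (Omega : set E) Q -> (forall x, Omega x -> range X (Q x)) ->
  sup [set edist (Q x) x | x in Omega] <= h ->
  solves_VI Omega (prob_on Omega) J mustar ->
  W1 muh mustar <= Num.sqrt (Lx / alpha * h).
Proof.
move=> mQ QX Qh [msO ms_VI].
have Qhx x : Omega x -> edist (Q x) x <= h.
  move=> Ox; apply: le_trans Qh; apply: ub_le_sup; last by exists x.
  exists D => _ [y Oy <-]; apply: edist_le_diam => //; exact/X_Omega/QX.
have [i0 _|I0] := pickP (@predT I); last first.
  case: (prob_mass_vec muhX) => _; rewrite big_pred0// => /eqP.
  by rewrite eq_sym oner_eq0.
(* Q is measurable on Omega only, so it is made constant elsewhere *)
pose Q' (x : E) : E := if x \in Omega then Q x else X i0.
have mQ' : measurable_fun setT Q'.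
  have memO : (fun x : E => x \in Omega) @^-1` [set true] = Omega.
    by apply/seteqP; split => x; [exact: set_mem|exact: mem_set].
  apply: measurable_fun_if => //.
  - apply: (measurable_fun_bool true); rewrite setTI memO.
    exact: mOmega.
  - by rewrite setTI memO.
have Q'X x : range X (Q' x).
  by rewrite /Q'; case: ifPn => [/set_mem/QX//|_]; exists i0.
pose eta := image_probability mustar mQ'.
have etaX : prob_on (range X) eta.
  rewrite /prob_on /mkset (_ : eta _ = mustar (Q' @^-1` range X))//.
  rewrite (_ : _ @^-1` _ = setT) ?probability_setT//.
  by apply/seteqP; split=> // x _; exact: Q'X.
have [M JM] := J_bounded muhO.
have step1 : pairing Omega (J muh) eta mustar <= Lx * h.
  apply: (pairing_image_le mOmega mQ' (J_measurable muhO) JM) => //.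
  - move=> x Ox; apply: le_trans (ler_norm _) _.
    rewrite /Q' mem_set// (le_trans (J_lipx muhO _ _))//.
      exact/X_Omega/QX.
    by rewrite ler_wpM2l ?(ltW Lx_gt0)// Qhx.
  - by move=> x; exact/X_Omega/Q'X.
have step2 := muh_VI.2 _ etaX.
have step3 := ms_VI _ muhO.
have := J_mono muhO msO.
rewrite pairingB//; try exact: J_integrable.
move=> mono.
have : alpha * W1 muh mustar ^+ 2 <= Lx * h.
  by move: step1 step2 step3 mono; rewrite /pairing; lra.
move=> key.
rewrite -[leLHS]ger0_norm ?W1_ge0// -sqrtr_sqr ler_wsqrtr//.
by rewrite mulrAC ler_pdivlMr// mulrC.
Qed.


Section iterates.
Variables (lambda : R) (mu nu : nat -> probability E R).
Hypothesis lambda_gt0 : 0 < lambda.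
Hypothesis iterates : KL_mirror_prox X J lambda mu nu.
Hypothesis mu0_full : supp (mu 0%N) = range X.
Hypothesis D_gt0 : 0 < D.
Hypothesis lambda_lt : lambda * Lm * D < 1.

Local Notation p k := (mass_vec (mu k)).
Local Notation q k := (mass_vec (nu k)).
Local Notation s := (mass_vec muh).
Local Notation Dk k := (rel_entropy s (p k)).
Local Notation c := (1 - lambda * Lm * D).

Let muX k : prob_on (range X) (mu k). Proof. by case: (iterates k). Qed.
Let nuX k : prob_on (range X) (nu k). Proof. by case: (iterates k). Qed.
Let muO k : prob_on Omega (mu k). Proof. exact: mesh_prob_on. Qed.
Let nuO k : prob_on Omega (nu k). Proof. exact: mesh_prob_on. Qed.
Let pP k : prob_vec (p k). Proof. exact: prob_mass_vec. Qed.
Let qP k : prob_vec (q k). Proof. exact: prob_mass_vec. Qed.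
Let sP : prob_vec s. Proof. exact: prob_mass_vec. Qed.
Let muA k : atomic X (p k) (mu k). Proof. exact: mass_vec_atomic. Qed.
Let nuA k : atomic X (q k) (nu k). Proof. exact: mass_vec_atomic. Qed.
Let muhA : atomic X s muh. Proof. exact: mass_vec_atomic. Qed.

Let gibbs_half k : gibbs_vec lambda (p k) (fun i => J (mu k) (X i)) (q k).
Proof. by case: (iterates k). Qed.

Let gibbs_full k : gibbs_vec lambda (p k) (fun i => J (nu k) (X i)) (p k.+1).
Proof. by case: (iterates k). Qed.

Lemma iterate_mass_gt0 k i : 0 < p k i.
Proof.
elim: k i => [i|k ih i]; last exact: (gibbs_vec_gt0 (pP k) ih (gibbs_full k)).
have : supp (mu 0%N) (X i) by rewrite mu0_full; exists i.
exact.
Qed.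

Lemma half_iterate_mass_gt0 k i : 0 < q k i.
Proof. exact: (gibbs_vec_gt0 (pP k) (iterate_mass_gt0 k) (gibbs_half k)). Qed.

Let p_gt0 := iterate_mass_gt0.
Let q_gt0 := half_iterate_mass_gt0.

Lemma KL_iterate k : KL muh (mu k) = (Dk k)%:E.
Proof. exact: (KL_atomic X_inj sP.1 (p_gt0 k) muhA (@muA k)). Qed.

Lemma iterate_entropy_ge0 k : 0 <= Dk k. Proof. exact: rel_entropy_ge0. Qed.

Lemma W1_half_step k : W1 (mu k) (nu k) <= D / 2 * l1_dist (p k) (q k).
Proof. exact: (W1_le_l1_dist Omega_compact X_inj XO). Qed.

Lemma monotone_descent k : alpha * W1 (nu k) muh ^+ 2 <=
  \sum_i J (nu k) (X i) * (q k i - s i).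
Proof.
have := J_mono (nuO k) muhO; have := muh_VI.2 _ (nuX k).
rewrite !pairing_mesh//; last 2 first.
- by apply: measurable_funB; exact: J_measurable.
- exact: J_measurable.
move=> VI mono; apply: le_trans mono _.
rewrite (eq_bigr (fun i => J (nu k) (X i) * (q k i - s i) -
  J muh (X i) * (q k i - s i))); last by move=> i _; ring.
by rewrite sumrB lerBlDr lerDl.
Qed.

(** The constant: W1 <= (D/2) |nu - mu|_1 for the Lipschitz bound, then
x y <= (x^2 + y^2) / 2 and Pinsker for both factors. *)
Lemma extrapolation_error k :
  \sum_i (J (nu k) (X i) - J (mu k) (X i)) * (q k i - p k.+1 i) <=
  Lm * D / 2 * (rel_entropy (q k) (p k) + rel_entropy (p k.+1) (q k)).
Proof.
set r := p k.+1; set KL1 := rel_entropy _ _; set KL2 := rel_entropy _ _.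
have pin1 : l1_dist (q k) (p k) ^+ 2 <= 2 * KL1 by exact: pinsker.
have pin2 : l1_dist r (q k) ^+ 2 <= 2 * KL2.
  exact: (pinsker (pP k.+1) (qP k) (@q_gt0 k)).
have W1b : W1 (nu k) (mu k) <= D / 2 * l1_dist (q k) (p k).
  exact: (W1_le_l1_dist Omega_compact X_inj XO).
have Jb i : (J (nu k) (X i) - J (mu k) (X i)) * (q k i - r i) <=
    Lm * (D / 2 * l1_dist (q k) (p k)) * `|r i - q k i|.
  apply: le_trans (ler_norm _) _; rewrite normrM [X in _ * X]distrC.
  rewrite ler_wpM2r// (le_trans (J_diff_le (nuO k) (muO k) (XO i)))//.
  by rewrite ler_wpM2l// ltW.
apply: (@le_trans _ _
  (\sum_i Lm * (D / 2 * l1_dist (q k) (p k)) * `|r i - q k i|)).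
  exact: ler_sum.
rewrite -mulr_sumr -/(l1_dist r (q k)).
set x := l1_dist (q k) (p k) in pin1 *; set y := l1_dist r (q k) in pin2 *.
have -> : Lm * (D / 2 * x) * y = Lm * D / 2 * (x * y) by ring.
rewrite ler_wpM2l ?divr_ge0 ?mulr_ge0 ?(ltW D_gt0) ?(ltW Lm_gt0)//.
by have := sqr_ge0 (x - y); rewrite sqrrB; lra.
Qed.

Lemma entropy_descent k :
  Dk k.+1 <= Dk k - lambda * alpha * W1 (nu k) muh ^+ 2
             - c * rel_entropy (q k) (p k).
Proof.
rewrite (mirror_prox_identity (pP k) (p_gt0 k) sP (gibbs_half k)
  (gibbs_full k)).
have := monotone_descent k; have := extrapolation_error k.
set A := \sum_i _; set B := \sum_i _; set KL1 := rel_entropy (q k) (p k).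
set KL2 := rel_entropy _ (q k); set W := W1 _ _ => hA hB.
have KL1_ge0 : 0 <= KL1 by exact: rel_entropy_ge0.
have KL2_ge0 : 0 <= KL2 by exact: rel_entropy_ge0.
have : lambda * A <= lambda * Lm * D / 2 * (KL1 + KL2).
  have -> : lambda * Lm * D / 2 * (KL1 + KL2) =
    lambda * (Lm * D / 2 * (KL1 + KL2)) by ring.
  by rewrite ler_pM2l.
have : lambda * (alpha * W ^+ 2) <= lambda * B by rewrite ler_pM2l.
have : 0 <= lambda * Lm * D by rewrite !mulr_ge0 ?ltW.
move: lambda_lt; set e := lambda * Lm * D => e1 e0.
nra.
Qed.

Local Notation beta := (2^-1 * Num.min (lambda * alpha) (c / (2 * D ^+ 2))).

Let la_gt0 : 0 < lambda * alpha. Proof. exact: mulr_gt0. Qed.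
Let c_gt0 : 0 < c. Proof. by rewrite subr_gt0. Qed.

Lemma beta_gt0 : 0 < beta.
Proof.
rewrite mulr_gt0// lt_min la_gt0 divr_gt0// mulr_gt0// exprn_gt0//.
Qed.

Lemma descent_W1 k : Dk k.+1 <= Dk k - beta * W1 (mu k) muh ^+ 2.
Proof.
have := entropy_descent k.
have tri : W1 (mu k) muh <= W1 (mu k) (nu k) + W1 (nu k) muh.
  exact: (W1_triangle Omega_compact X_inj XO (pP k) (qP k)).
have half := W1_half_step k.
have pin : l1_dist (q k) (p k) ^+ 2 <= 2 * rel_entropy (q k) (p k).
  exact: pinsker.
move: tri half; rewrite l1_distC; move: pin.
have x0 := l1_dist_ge0 (q k) (p k).
set KL1 := rel_entropy (q k) (p k); set x := l1_dist _ _ in x0 *.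
have := W1_ge0 (mu k) (nu k); have := W1_ge0 (nu k) muh.
have := W1_ge0 (mu k) muh.
set a := W1 (mu k) (nu k); set b := W1 (nu k) muh; set w := W1 (mu k) muh.
move=> w0 b0 a0 pin tri half.
set mn := Num.min _ _.
have mn1 : mn <= lambda * alpha by rewrite ge_min lexx.
have mn2 : mn * (2 * D ^+ 2) <= c.
  by rewrite -ler_pdivlMr ?mulr_gt0 ?exprn_gt0// ge_min lexx orbT.
have mn0 : 0 <= mn.
  by rewrite le_min ltW//= divr_ge0 ?(ltW c_gt0)// mulr_ge0 ?sqr_ge0.
have wab : w ^+ 2 <= 2 * (a ^+ 2 + b ^+ 2).
  have : w ^+ 2 <= (a + b) ^+ 2 by rewrite lerXn2r ?nnegrE ?addr_ge0.
  by have := sqr_ge0 (a - b); rewrite sqrrB sqrrD; lra.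
have aKL : a ^+ 2 <= D ^+ 2 / 2 * KL1.
  have : a ^+ 2 <= (D / 2 * x) ^+ 2.
    by rewrite lerXn2r ?nnegrE ?mulr_ge0// ?divr_ge0 ?(ltW D_gt0).
  have : D ^+ 2 * x ^+ 2 <= D ^+ 2 * (2 * KL1) by rewrite ler_wpM2l ?sqr_ge0.
  by rewrite exprMn; lra.
have KL0 : 0 <= KL1 by have := sqr_ge0 x; lra.
have h1 : mn * b ^+ 2 <= lambda * alpha * b ^+ 2 by rewrite ler_wpM2r ?sqr_ge0.
have h2 : mn * a ^+ 2 <= mn * (D ^+ 2 / 2 * KL1) by rewrite ler_wpM2l.
have h3 : mn * (2 * D ^+ 2) * KL1 <= c * KL1 by rewrite ler_wpM2r.
have h4 : mn * w ^+ 2 <= mn * (2 * (a ^+ 2 + b ^+ 2)) by rewrite ler_wpM2l.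
have h5 : 0 <= mn * D ^+ 2 * KL1 := mulr_ge0 (mulr_ge0 mn0 (sqr_ge0 D)) KL0.
lra.
Qed.

(** [descent_W1] telescopes. *)
Lemma sum_W1_sqr_le K : \sum_(k < K) W1 (mu k) muh ^+ 2 <= Dk 0%N / beta.
Proof.
rewrite ler_pdivlMr ?beta_gt0// mulrC.
have h : Dk K + beta * \sum_(k < K) W1 (mu k) muh ^+ 2 <= Dk 0%N.
  elim: K => [|K ih]; first by rewrite big_ord0 mulr0 addr0.
  by rewrite big_ord_recr/= mulrDr; have := descent_W1 K; lra.
by apply: le_trans h; rewrite lerDr iterate_entropy_ge0.
Qed.

Section best_and_average.
Variable K : nat.
Hypothesis K_gt0 : (0 < K)%N.

Let K0 : 0 < K%:R :> R. Proof. by rewrite ltr0n. Qed.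

Let bound_ge0 : 0 <= Dk 0%N / (beta * K%:R).
Proof. by rewrite divr_ge0 ?iterate_entropy_ge0// mulr_ge0 ?(ltW beta_gt0)// ltW. Qed.

Lemma best_iterate :
  exists2 k, (k < K)%N & W1 (mu k) muh <= Num.sqrt (Dk 0%N / (beta * K%:R)).
Proof.
case: (pselect (exists2 k, (k < K)%N &
  W1 (mu k) muh <= Num.sqrt (Dk 0%N / (beta * K%:R)))) => // no; exfalso.
have big k : (k < K)%N -> Dk 0%N / (beta * K%:R) < W1 (mu k) muh ^+ 2.
  move=> kK; have := bound_ge0; set B := _ / _ => B0.
  have : Num.sqrt B < W1 (mu k) muh.
    by rewrite ltNge; apply/negP => le; apply: no; exists k.
  rewrite -{2}(sqr_sqrtr B0) => lt.
  by rewrite ltrXn2r ?nnegrE ?sqrtr_ge0 ?W1_ge0.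
have : Dk 0%N / beta < \sum_(k < K) W1 (mu k) muh ^+ 2.
  have -> : Dk 0%N / beta = \sum_(k < K) Dk 0%N / (beta * K%:R).
    rewrite sumr_const card_ord -[_ *+ K]mulr_natr.
    have := beta_gt0; set b := 2^-1 * _ => b0.
    by field; rewrite !gt_eqF.
  case: K K_gt0 big => // K' _ big.
  apply: ltr_sum => [|k _]; last exact: big.
  by apply/hasP; exists ord0 => //; rewrite mem_index_enum.
by rewrite ltNge sum_W1_sqr_le.
Qed.

(** Convexity, then Cauchy-Schwarz to pass from the mean of the distances to
the mean of their squares. *)
Lemma average_iterate :
  W1 (average mu K) muh <= Num.sqrt (Dk 0%N / (beta * K%:R)).
Proof.
have avg := W1_average_le Omega_compact X_inj XO pP muA K_gt0 sP muhA.
apply: le_trans avg _.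
set S := \sum_(k < K) _.
have S0 : 0 <= S by rewrite sumr_ge0// => k _; exact: W1_ge0.
have S2 : S ^+ 2 <= K%:R * (Dk 0%N / beta).
  have := @cauchy_schwarz_sum R _ (fun=> 1) (fun k : 'I_K => W1 (mu k) muh).
  rewrite (eq_bigr (fun k : 'I_K => W1 (mu k) muh)); last first.
    by move=> k _; rewrite mul1r.
  rewrite -/S (eq_bigr (fun=> 1)); last by move=> k _; rewrite expr1n.
  rewrite sumr_const card_ord => /le_trans; apply.
  by rewrite ler_wpM2l ?sum_W1_sqr_le.
rewrite -[leLHS]ger0_norm ?mulr_ge0 ?invr_ge0 ?(ltW K0)// -sqrtr_sqr.
rewrite ler_wsqrtr//.
rewrite exprMn exprVn -ler_pdivlMl ?invr_gt0 ?exprn_gt0// invrK.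
apply: le_trans S2 _; rewrite le_eqVlt; apply/orP; left; apply/eqP.
have := beta_gt0; set b := 2^-1 * _ => b0.
by field; rewrite !gt_eqF.
Qed.

End best_and_average.

Variable delta : R.
Hypothesis delta_gt0 : 0 < delta.
Hypothesis deltaX : forall i j, i != j -> delta <= edist (X i) (X j).
Local Notation gamma := (4^-1 * Num.min (lambda * alpha * delta ^+ 2 / 2) c).

Lemma gamma_gt0 : 0 < gamma.
Proof. by rewrite mulr_gt0// lt_min c_gt0 divr_gt0// mulr_gt0// exprn_gt0. Qed.

Lemma gamma_le : gamma <= 4^-1.
Proof.
have : Num.min (lambda * alpha * delta ^+ 2 / 2) c <= c.
  by rewrite ge_min lexx orbT.
have : 0 <= lambda * Lm * D by rewrite !mulr_ge0 ?ltW.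
lra.
Qed.

Lemma descent_l1 k : Dk k.+1 <= Dk k - gamma * l1_dist s (p k) ^+ 2.
Proof.
have := entropy_descent k.
have pin : l1_dist (q k) (p k) ^+ 2 <= 2 * rel_entropy (q k) (p k).
  exact: pinsker.
have tri : l1_dist s (p k) <= l1_dist s (q k) + l1_dist (q k) (p k).
  exact: l1_dist_triangle.
have low : delta / 2 * l1_dist s (q k) <= W1 (nu k) muh.
  rewrite l1_distC.
  exact: (l1_dist_le_W1 Omega_compact X_inj XO (qP k) sP (@nuA k) muhA
    (ltW delta_gt0) deltaX).
move: pin tri low.
have := l1_dist_ge0 s (p k); have := l1_dist_ge0 s (q k).
have := l1_dist_ge0 (q k) (p k).
set KL1 := rel_entropy (q k) (p k); set x := l1_dist (q k) (p k).
set y := l1_dist s (q k); set z := l1_dist s (p k); set b := W1 _ _.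
move=> x0 y0 z0 pin tri low.
set mn := Num.min _ _.
have mn1 : mn <= lambda * alpha * delta ^+ 2 / 2 by rewrite ge_min lexx.
have mn2 : mn <= c by rewrite ge_min lexx orbT.
have mn0 : 0 <= mn.
  by rewrite le_min (ltW c_gt0) andbT divr_ge0// mulr_ge0 ?sqr_ge0// ltW.
have zxy : z ^+ 2 <= 2 * (x ^+ 2 + y ^+ 2).
  have : z ^+ 2 <= (y + x) ^+ 2 by rewrite lerXn2r ?nnegrE ?addr_ge0.
  by have := sqr_ge0 (x - y); rewrite sqrrB sqrrD; lra.
have yb : (delta / 2) ^+ 2 * y ^+ 2 <= b ^+ 2.
  rewrite -exprMn lerXn2r ?nnegrE ?mulr_ge0 ?divr_ge0 ?(ltW delta_gt0)//.
  exact: W1_ge0.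
have h1 : mn * y ^+ 2 <= lambda * alpha * delta ^+ 2 / 2 * y ^+ 2.
  by rewrite ler_wpM2r ?sqr_ge0.
have h2 : lambda * alpha * ((delta / 2) ^+ 2 * y ^+ 2) <=
    lambda * alpha * b ^+ 2.
  by rewrite ler_wpM2l// ltW.
have h3 : mn * x ^+ 2 <= c * x ^+ 2 by rewrite ler_wpM2r ?sqr_ge0.
have h4 : c * x ^+ 2 <= c * (2 * KL1) by rewrite ler_wpM2l// ltW.
have h5 : mn * z ^+ 2 <= mn * (2 * (x ^+ 2 + y ^+ 2)) by rewrite ler_wpM2l.
have e2 : lambda * alpha * ((delta / 2) ^+ 2 * y ^+ 2) =
  lambda * alpha * delta ^+ 2 * y ^+ 2 / 4 by field.
lra.
Qed.

Lemma W1_le_sqrt_entropy k : W1 (mu k) muh <= D * Num.sqrt (2 * Dk k).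
Proof.
apply: (@le_trans _ _ (D / 2 * l1_dist (p k) s)).
  exact: (W1_le_l1_dist Omega_compact X_inj XO).
have : l1_dist (p k) s <= Num.sqrt (2 * Dk k).
  rewrite l1_distC -[leLHS]ger0_norm ?l1_dist_ge0// -sqrtr_sqr ler_wsqrtr//.
  exact: pinsker.
have := l1_dist_ge0 (p k) s.
set x := l1_dist _ _; set y := Num.sqrt _ => x0 xy.
have : D * x <= D * y by rewrite ler_wpM2l// ltW.
have : 0 <= D * x by rewrite mulr_ge0// ltW.
lra.
Qed.

Lemma entropy_nonincreasing j k : (j <= k)%N -> Dk k <= Dk j.
Proof.
move=> jk; rewrite -(subnK jk); elim: (k - j)%N => // n ih.
apply: le_trans (descent_l1 _) (le_trans _ ih).
by rewrite gerBl mulr_ge0 ?(ltW gamma_gt0) ?sqr_ge0.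
Qed.

Variable m : R.
Hypotheses (m_gt0 : 0 < m) (m_le1 : m <= 1).

(** m^2/8 is the level of the divergence at which Pinsker gives
|muh - mu_k|_1 <= m/2. *)
Let T_gt0 : 0 < m ^+ 2 / 8. Proof. by rewrite divr_gt0// exprn_gt0. Qed.

Let close_l1 k : Dk k <= m ^+ 2 / 8 -> l1_dist s (p k) <= m / 2.
Proof.
move=> Dm; have : l1_dist s (p k) ^+ 2 <= 2 * Dk k by exact: pinsker.
move=> pin.
rewrite -(ler_pXn2r (n := 2))// ?nnegrE ?l1_dist_ge0 ?divr_ge0 ?(ltW m_gt0)//.
have -> : (m / 2) ^+ 2 = m ^+ 2 / 4 by field.
lra.
Qed.

Lemma sublinear_rate : (forall i, 0 < s i -> m <= s i) ->
  exists2 k0 : nat, k0%:Z <= Num.ceil (256 * Dk 0%N / (gamma * m ^+ 4)) &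
    forall k, (k0 <= k)%N ->
      Dk k <= (8 / m ^+ 2 + gamma / 4 * (k - k0)%:R)^-1.
Proof.
move=> sm.
have e_gt0 : 0 < gamma * m ^+ 4 / 256.
  by rewrite divr_gt0// mulr_gt0 ?gamma_gt0 ?exprn_gt0.
have far k : m ^+ 2 / 8 < Dk k -> Dk k.+1 <= Dk k - gamma * m ^+ 4 / 256.
  move=> Dm; apply: le_trans (descent_l1 k) _.
  rewrite lerD2l lerN2 -mulrA ler_wpM2l ?(ltW gamma_gt0)//.
  have -> : m ^+ 4 / 256 = (m ^+ 2 / 16) ^+ 2 by field.
  rewrite lerXn2r ?nnegrE ?l1_dist_ge0 ?divr_ge0 ?sqr_ge0//.
  (* an l1 distance below m^2/16 would force Dk k <= m^2/12 *)
  rewrite leNgt; apply/negP => l1m.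
  have l1m2 : l1_dist s (p k) <= m / 2.
    have : m ^+ 2 <= m by rewrite expr2 ler_piMr// ltW.
    by move: m_gt0; lra.
  have := rel_entropy_le_l1 sP (pP k) (p_gt0 k) l1m2 sm.
  by have := exprn_gt0 2 m_gt0; lra.
have [k0 k0le k0T] := hitting_time (u := fun k => Dk k)
  (iterate_entropy_ge0 0%N) e_gt0 (ltW T_gt0) far.
exists k0.
  move: k0le; congr (_ <= Num.ceil _).
  have := gamma_gt0; set g := 4^-1 * _ => g0.
  by field; rewrite !gt_eqF.
move=> k k0k; rewrite -{1}(subnKC k0k).
apply: (reciprocal_decay (u := fun j => Dk (k0 + j)%N)).
- by rewrite divr_gt0// exprn_gt0.
- by rewrite divr_gt0// gamma_gt0.
- by move=> j; exact: iterate_entropy_ge0.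
- by rewrite addn0 invf_div.
- move=> j; rewrite addnS; apply: le_trans (descent_l1 _) _.
  have Dm : Dk (k0 + j)%N <= m ^+ 2 / 8.
    by apply: le_trans k0T; apply: entropy_nonincreasing; rewrite leq_addr.
  have := rel_entropy_le_l1 sP (pP _) (p_gt0 _) (close_l1 Dm) sm.
  have := iterate_entropy_ge0 (k0 + j)%N; have := l1_dist_ge0 s (p (k0 + j)%N).
  set x := l1_dist _ _; set z := rel_entropy _ _ => x0 z0 zx.
  have zx2 : z ^+ 2 / 4 <= x ^+ 2 by nra.
  rewrite lerD2l lerN2; have := gamma_gt0; set g := 4^-1 * _ => g0.
  have : g * (z ^+ 2 / 4) <= g * x ^+ 2 by rewrite ler_pM2l.
  lra.
Qed.

Lemma linear_rate : (forall i, m <= s i) ->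
  exists2 k0 : nat, k0%:Z <= Num.ceil (8 * Dk 0%N / (gamma * m ^+ 3)) &
    forall k, (k0 <= k)%N ->
      Dk k <= m ^+ 2 / 8 * (1 - gamma * m) ^+ (k - k0).
Proof.
move=> sm.
have e_gt0 : 0 < gamma * m ^+ 3 / 8.
  by rewrite divr_gt0// mulr_gt0 ?gamma_gt0 ?exprn_gt0.
have far k : m ^+ 2 / 8 < Dk k -> Dk k.+1 <= Dk k - gamma * m ^+ 3 / 8.
  move=> Dm; apply: le_trans (descent_l1 k) _.
  rewrite lerD2l lerN2 -mulrA ler_wpM2l ?(ltW gamma_gt0)//.
  (* a squared l1 distance below m^3/8 would force Dk k <= m^2/12 *)
  rewrite leNgt; apply/negP => l1m.
  have m32 : m ^+ 3 <= m ^+ 2 by rewrite ler_wiXn2l// ltW.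
  have l1m2 : l1_dist s (p k) <= m / 2.
    rewrite -(ler_pXn2r (n := 2))// ?nnegrE ?l1_dist_ge0 ?divr_ge0//;
      last exact: ltW.
    have -> : (m / 2) ^+ 2 = m ^+ 2 / 4 by field.
    by have := exprn_gt0 2 m_gt0; lra.
  have := rel_entropy_le_l1_sqr sP (pP k) (p_gt0 k) m_gt0 l1m2 sm.
  have : 2 / (3 * m) * l1_dist s (p k) ^+ 2 <= 2 / (3 * m) * (m ^+ 3 / 8).
    by rewrite ler_wpM2l ?(ltW l1m)// divr_ge0// mulr_ge0// ltW.
  have -> : 2 / (3 * m) * (m ^+ 3 / 8) = m ^+ 2 / 12 by field; rewrite gt_eqF.
  by have := exprn_gt0 2 m_gt0; lra.
have [k0 k0le k0T] := hitting_time (u := fun k => Dk k)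
  (iterate_entropy_ge0 0%N) e_gt0 (ltW T_gt0) far.
exists k0.
  move: k0le; congr (_ <= Num.ceil _).
  have := gamma_gt0; set g := 4^-1 * _ => g0.
  by field; rewrite !gt_eqF.
have gm : gamma * m <= 1.
  by have := gamma_le; have := gamma_gt0; move: m_gt0 m_le1; nra.
move=> k k0k; rewrite -{1}(subnKC k0k).
apply: (geometric_decay (u := fun j => Dk (k0 + j)%N)).
- by rewrite subr_ge0.
- by rewrite addn0.
- move=> j; rewrite addnS; apply: le_trans (descent_l1 _) _.
  have Dm : Dk (k0 + j)%N <= m ^+ 2 / 8.
    by apply: le_trans k0T; apply: entropy_nonincreasing; rewrite leq_addr.
  have := rel_entropy_le_l1_sqr sP (pP _) (p_gt0 _) m_gt0 (close_l1 Dm) sm.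
  have := iterate_entropy_ge0 (k0 + j)%N; have := sqr_ge0 (l1_dist s (p (k0 + j)%N)).
  set x := l1_dist _ _ ^+ 2; set z := rel_entropy _ _ => x0 z0 zx.
  have mzx : m * z <= x.
    have : m * z <= m * (2 / (3 * m) * x) by rewrite ler_wpM2l// ltW.
    have -> : m * (2 / (3 * m) * x) = 2 / 3 * x by field; rewrite gt_eqF.
    lra.
  have := gamma_gt0; set g := 4^-1 * _ => g0.
  have : g * (m * z) <= g * x by rewrite ler_pM2l.
  lra.
Qed.

End iterates.
End mesh.
End mirror_prox.

(** * The constants of the mesh *)

(** Infima over nonempty finite families are minima. *)
Lemma inf_finite_image (R : realType) (T : finType) (P : pred T) (F : T -> R)
    (t0 : T) : P t0 ->
  (exists2 t, P t & inf [set F t | t in [set t | P t]] = F t) /\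
  (forall t, P t -> inf [set F t | t in [set t | P t]] <= F t).
Proof.
move=> Pt0.
have [t1 Pt1 t1_min] := @Order.TotalTheory.arg_minP _ _ _ t0 P F Pt0.
have lb : lbound [set F t | t in [set t | P t]] (F t1).
  by move=> _ [t /= Pt <-]; exact: t1_min.
split.
  exists t1 => //; apply/eqP; rewrite eq_le; apply/andP; split.
    by apply: ge_inf; [exists (F t1)|exists t1].
  by apply: lb_le_inf => //; exists (F t1), t1.
by move=> t Pt; apply: ge_inf; [exists (F t1)|exists t].
Qed.

Section mesh_constants.
Context {R : realType} {d N : nat} (X : 'I_N -> Rn R d) (X_inj : injective X).

Lemma mesh_sep_gt0 : (2 <= N)%N -> 0 < mesh_sep X.
Proof.
move=> N2.
pose i0 := Ordinal (leq_trans (isT : (0 < 2)%N) N2).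
pose i1 := Ordinal (leq_trans (isT : (1 < 2)%N) N2).
pose P (p : 'I_N * 'I_N) := p.1 != p.2.
have [] := @inf_finite_image R _ P (fun p => edist (X p.1) (X p.2))
  (i0, i1) isT.
rewrite /mesh_sep => -[p Pp ->] _; apply: edist_gt0.
by apply: contra Pp => /eqP/X_inj ->.
Qed.

Lemma mesh_sep_le i j : i != j -> mesh_sep X <= edist (X i) (X j).
Proof.
move=> ij; pose P (p : 'I_N * 'I_N) := p.1 != p.2.
have [_] := @inf_finite_image R _ P (fun p => edist (X p.1) (X p.2)) (i, j) ij.
by move/(_ (i, j) ij).
Qed.

Variable mu : probability (Rn R d) R.
Hypothesis muX : prob_on (range X) mu.

Let s := mass_vec X mu.
Let sP : prob_vec s. Proof. exact: prob_mass_vec. Qed.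
Let muA : atomic X s mu. Proof. exact: mass_vec_atomic. Qed.

(** The support is contained in the mesh, so the infimum is over finitely many
indices. *)
Lemma min_massE :
  min_mass mu = inf [set s i | i in [set i | 0 < s i]].
Proof.
congr inf; apply/seteqP; split=> [_ [x /= x0 <-]|_ [i /= si <-]];
  last by exists (X i).
case: (pselect (range X x)) => [[i _ Xi]|Xx].
  by exists i; rewrite /= /s /mass_vec Xi.
exfalso; move: x0; rewrite /supp /= /mass.
rewrite (_ : mu [set x] = 0%E) ?ltxx//.
transitivity (\sum_i (s i)%:E * \d_(X i) [set x])%E.
  by apply: muA; exact: measurable_singleton.
rewrite big1// => i _; rewrite diracE memNset ?mule0//= => Xi.
by apply: Xx; exists i.
Qed.

Let s_pos : exists i, 0 < s i.
Proof.
apply: contrapT => no; have [s0 s1] := sP.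
have : \sum_i s i = 0.
  apply: big1 => i _; apply/eqP; rewrite eq_le s0 andbT leNgt.
  by apply/negP => si; apply: no; exists i.
by move/eqP; rewrite s1 oner_eq0.
Qed.

Lemma min_mass_le i : 0 < s i -> min_mass mu <= s i.
Proof.
move=> si; rewrite min_massE.
by have [_] := @inf_finite_image R _ (fun i => 0 < s i) s i si; apply.
Qed.

Lemma min_mass_gt0 : 0 < min_mass mu.
Proof.
have [i0 si0] := s_pos; rewrite min_massE.
by have [[i si ->] _] := @inf_finite_image R _ (fun i => 0 < s i) s i0 si0.
Qed.

Lemma min_mass_le1 : min_mass mu <= 1.
Proof.
have [i si] := s_pos; apply: le_trans (min_mass_le si) _.
rewrite -sP.2 (bigD1 i)//= lerDl sumr_ge0// => j _; exact: sP.1.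
Qed.

End mesh_constants.

(** * Convergence to the continuous equilibrium *)

Theorem theorem4p2 (R : realType) (d : nat) (Omega : set 'rV[R]_d)
  (Omega_neq0 : Omega !=set0) (Omega_compact : compact Omega)
  (J : probability (Rn R d) R -> 'rV[R]_d -> R)
  (J_cont : forall mu, prob_on Omega mu -> {within Omega, continuous (J mu)})
  (Lm : R) (Lm_gt0 : 0 < Lm)
  (J_lip : forall mu nu, prob_on Omega mu -> prob_on Omega nu ->
    sup_norm Omega (fun x => J mu x - J nu x) <= Lm * W1 mu nu)
  (alpha : R) (alpha_gt0 : 0 < alpha)
  (J_mono : forall rho sigma, prob_on Omega rho -> prob_on Omega sigma ->
    alpha * W1 rho sigma ^+ 2 <=
      pairing Omega (fun x => J rho x - J sigma x) rho sigma)
  (Lx : R) (Lx_gt0 : 0 < Lx)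
  (J_lipx : forall rho x y, prob_on Omega rho -> Omega x -> Omega y ->
    `|J rho x - J rho y| <= Lx * edist x y)
  (h : R) (h_gt0 : 0 < h)
  (N : nat) (N_ge2 : (2 <= N)%N)
  (X : 'I_N -> Rn R d) (X_inj : injective X) (X_Omega : range X `<=` Omega)
  (Q : Rn R d -> Rn R d) (Q_meas : measurable_fun (Omega : set (Rn R d)) Q)
  (Q_X : forall x, Omega x -> range X (Q x))
  (Q_h : sup [set edist (Q x) x | x in Omega] <= h)
  (lambda : R) (lambda_gt0 : 0 < lambda)
  (lambda_lt : lambda < 1 / (Lm * diam Omega))
  (mu nu : nat -> probability (Rn R d) R)
  (iterates : KL_mirror_prox X J lambda mu nu)
  (mu0_full : supp (mu 0%N) = range X)
  (muh : probability (Rn R d) R)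
  (muh_VI : solves_VI Omega (prob_on (range X)) J muh)
  (mustar : probability (Rn R d) R)
  (mustar_VI : solves_VI Omega (prob_on Omega) J mustar) :
  let D := diam Omega in
  let delta := mesh_sep X in
  let m := min_mass muh in
  let D0 := fine (KL muh (mu 0%N)) in
  let beta := 2^-1 *
    Num.min (lambda * alpha) ((1 - lambda * Lm * D) / (2 * D ^+ 2)) in
  let gamma := 4^-1 *
    Num.min (lambda * alpha * delta ^+ 2 / 2) (1 - lambda * Lm * D) in
  let err := Num.sqrt (Lx / alpha * h) in
  let rate k0 k := 8 / m ^+ 2 + gamma / 4 * (k - k0)%:R in
  [/\
    exists k0 : nat,
      [/\ k0%:Z <= Num.ceil (256 * D0 / (gamma * m ^+ 4)),
          forall k, (k0 <= k)%N -> (KL muh (mu k) <= ((rate k0 k)^-1)%:E)%E,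
          forall k, (k0 <= k)%N ->
            W1 (mu k) muh <= D * Num.sqrt (2 * (rate k0 k)^-1) &
          forall k, (k0 <= k)%N ->
            W1 (mu k) mustar <= D * Num.sqrt (2 / rate k0 k) + err],
    supp muh = range X ->
    exists k0 : nat,
      [/\ k0%:Z <= Num.ceil (8 * D0 / (gamma * m ^+ 3)),
          forall k, (k0 <= k)%N ->
            (KL muh (mu k) <= (m ^+ 2 / 8 * (1 - gamma * m) ^+ (k - k0))%:E)%E,
          forall k, (k0 <= k)%N ->
            W1 (mu k) muh <=
              D * (m / 2) * (1 - gamma * m) `^ ((k - k0)%:R / 2) &
          forall k, (k0 <= k)%N ->
            W1 (mu k) mustar <=
              D * (m / 2) * (1 - gamma * m) `^ ((k - k0)%:R / 2) + err],
    (forall K : nat, (1 <= K)%N ->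
      inf [set W1 (mu k) mustar | k in [set k | (k <= K - 1)%N]] <=
        Num.sqrt (D0 / (beta * K%:R)) + err) /\
    (forall (eps : R) (K : nat), 0 < eps -> (1 <= K)%N ->
      h <= alpha * eps ^+ 2 / (4 * Lx) ->
      4 * D0 / (eps ^+ 2 * beta) <= K%:R ->
      exists2 k : nat, (k <= K - 1)%N & W1 (mu k) mustar <= eps) &
    (forall K : nat, (1 <= K)%N ->
      W1 (average mu K) mustar <= Num.sqrt (D0 / (beta * K%:R)) + err) /\
    (forall (eps : R) (K : nat), 0 < eps -> (1 <= K)%N ->
      h <= alpha * eps ^+ 2 / (4 * Lx) ->
      4 * D0 / (eps ^+ 2 * beta) <= K%:R ->
      W1 (average mu K) mustar <= eps)].
Proof.
move=> D delta m D0 beta gamma err rate.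
have [muhX _] := muh_VI.
have sP := prob_mass_vec X_inj muhX.
have sA := mass_vec_atomic X_inj muhX.
pose i0 := Ordinal (leq_trans (isT : (0 < 2)%N) N_ge2).
pose i1 := Ordinal (leq_trans (isT : (1 < 2)%N) N_ge2).
have XO i : Omega (X i) by apply: X_Omega; exists i.
have D_gt0 : 0 < D.
  apply: (diam_gt0 Omega_compact (XO i0) (XO i1)).
  by apply/eqP => /X_inj.
have lambda_lt1 : lambda * Lm * D < 1.
  by move: lambda_lt; rewrite ltr_pdivlMr ?mulr_gt0// mulrA.
have KLE := KL_iterate X_inj muh_VI iterates mu0_full.
have D0E : D0 = rel_entropy (mass_vec X muh) (mass_vec X (mu 0%N)).
  by rewrite /D0 KLE.
have muX k : prob_on (range X) (mu k) by case: (iterates k).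
have muP k := prob_mass_vec X_inj (muX k).
have muA k := mass_vec_atomic X_inj (muX k).
have [mustarO _] := mustar_VI.
have gap : W1 muh mustar <= err.
  exact: (W1_equilibria Omega_compact J_cont alpha_gt0 J_mono Lx_gt0 J_lipx X_inj
    X_Omega muh_VI Q_meas Q_X Q_h mustar_VI).
have tri k : W1 (mu k) mustar <= W1 (mu k) muh + err.
  apply: le_trans (W1_triangle Omega_compact X_inj XO (muP k) sP (@muA k) sA
    mustarO) _.
  by rewrite lerD2l.
have m_gt0 : 0 < m := min_mass_gt0 X_inj muhX.
have m_le1 : m <= 1 := min_mass_le1 X_inj muhX.
have m_le i : 0 < mass_vec X muh i -> m <= mass_vec X muh i.
  exact: (min_mass_le X_inj muhX).
have delta_gt0 : 0 < delta := mesh_sep_gt0 X_inj N_ge2.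
have deltaX i j : i != j -> delta <= edist (X i) (X j) by exact: mesh_sep_le.
have W1D k := W1_le_sqrt_entropy Omega_compact X_inj X_Omega muh_VI iterates
  mu0_full D_gt0 k.
have W1_rate k (e : R) : rel_entropy (mass_vec X muh) (mass_vec X (mu k)) <= e ->
    W1 (mu k) muh <= D * Num.sqrt (2 * e).
  move=> De; apply: le_trans (W1D k) _.
  by rewrite ler_wpM2l ?(ltW D_gt0)// ler_wsqrtr// ler_wpM2l.
have beta0 : 0 < beta := beta_gt0 alpha_gt0 lambda_gt0 D_gt0 lambda_lt1.
have D0_ge0 : 0 <= D0.
  by rewrite D0E; exact: (iterate_entropy_ge0 X_inj muh_VI iterates mu0_full).
have small (eps : R) (K : nat) : 0 < eps -> (1 <= K)%N ->
    h <= alpha * eps ^+ 2 / (4 * Lx) -> 4 * D0 / (eps ^+ 2 * beta) <= K%:R ->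
    Num.sqrt (D0 / (beta * K%:R)) + err <= eps.
  move=> eps0 K1 h_le K_ge.
  have K0 : 0 < K%:R :> R by rewrite ltr0n.
  have e2 : 0 <= eps / 2 by rewrite divr_ge0// ltW.
  have e24 : (eps / 2) ^+ 2 = eps ^+ 2 / 4 by field.
  have s1 : Num.sqrt (D0 / (beta * K%:R)) <= eps / 2.
    rewrite -[leRHS]ger0_norm// -sqrtr_sqr ler_wsqrtr// e24.
    rewrite ler_pdivrMr ?(mulr_gt0 beta0 K0)//; move: K_ge.
    rewrite ler_pdivrMr ?(mulr_gt0 (exprn_gt0 2 eps0) beta0)//.
    have -> : eps ^+ 2 / 4 * (beta * K%:R) = K%:R * (eps ^+ 2 * beta) / 4.
      by field.
    lra.
  have s2 : err <= eps / 2.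
    rewrite -[leRHS]ger0_norm// -sqrtr_sqr ler_wsqrtr// e24.
    rewrite mulrAC ler_pdivrMr//; move: h_le.
    rewrite ler_pdivlMr ?mulr_gt0// => h_le.
    have -> : eps ^+ 2 / 4 * alpha = alpha * eps ^+ 2 / 4 by field.
    have -> : Lx * h = h * (4 * Lx) / 4 by field.
    by lra.
  by apply: le_trans (lerD s1 s2) _; rewrite -splitr.
have best (K : nat) : (1 <= K)%N -> exists2 k : nat, (k <= K - 1)%N &
    W1 (mu k) mustar <= Num.sqrt (D0 / (beta * K%:R)) + err.
  move=> K1; have [k kK kW] := best_iterate Omega_compact J_cont Lm_gt0 J_lip
    alpha_gt0 J_mono Lx_gt0 J_lipx X_inj X_Omega muh_VI lambda_gt0 iterates
    mu0_full D_gt0 lambda_lt1 K1.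
  exists k; first by rewrite subn1 -ltnS prednK.
  by apply: le_trans (tri k) _; rewrite lerD2r D0E.
have avg (K : nat) : (1 <= K)%N ->
    W1 (average mu K) mustar <= Num.sqrt (D0 / (beta * K%:R)) + err.
  move=> K1; have avgW := average_iterate Omega_compact J_cont Lm_gt0 J_lip
    alpha_gt0 J_mono Lx_gt0 J_lipx X_inj X_Omega muh_VI lambda_gt0 iterates
    mu0_full D_gt0 lambda_lt1 K1.
  have avgP := prob_average_vec muP K1.
  have avgA := @atomic_average _ _ _ X mu _ muA K.
  apply: le_trans (W1_triangle Omega_compact X_inj XO avgP sP avgA sA
    mustarO) _.
  by rewrite lerD// D0E.
split.
- have [k0 k0le rate_le] := sublinear_rate Omega_compact J_cont Lm_gt0 J_lip
    alpha_gt0 J_mono Lx_gt0 J_lipx X_inj X_Omega muh_VI lambda_gt0 iterates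
    mu0_full D_gt0 lambda_lt1 delta_gt0 deltaX m_gt0 m_le1 m_le.
  exists k0; split=> [|k k0k|k k0k|k k0k].
  + by rewrite D0E.
  + by rewrite KLE lee_fin; exact: rate_le.
  + exact/W1_rate/rate_le.
  + by apply: le_trans (tri k) _; rewrite lerD2r; exact/W1_rate/rate_le.
- move=> muh_full.
  have m_le' i : m <= mass_vec X muh i.
    by apply: m_le; have : supp muh (X i) by rewrite muh_full; exists i.
  have [k0 k0le rate_le] := linear_rate Omega_compact J_cont Lm_gt0 J_lip
    alpha_gt0 J_mono Lx_gt0 J_lipx X_inj X_Omega muh_VI lambda_gt0 iterates
    mu0_full D_gt0 lambda_lt1 delta_gt0 deltaX m_gt0 m_le1 m_le'.
  have gm : 0 <= 1 - gamma * m.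
    have g0 : 0 < gamma := gamma_gt0 alpha_gt0 lambda_gt0 lambda_lt1 delta_gt0.
    have g4 : gamma <= 4^-1 by exact: gamma_le.
    rewrite subr_ge0 mulr_ile1 ?(ltW g0) ?(ltW m_gt0)// (le_trans g4)//.
    by rewrite invf_le1 ?ler1n.
  have W1_lin k : (k0 <= k)%N -> W1 (mu k) muh <=
      D * (m / 2) * (1 - gamma * m) `^ ((k - k0)%:R / 2).
    move=> k0k; apply: le_trans (W1_rate _ _ (rate_le k k0k)) _.
    rewrite -[leRHS]mulrA ler_wpM2l ?(ltW D_gt0)//.
    have -> : 2 * (m ^+ 2 / 8 * (1 - gamma * m) ^+ (k - k0)) =
        (m / 2) ^+ 2 * (1 - gamma * m) ^+ (k - k0) by field.
    rewrite sqrtrM ?sqr_ge0// sqrtr_sqr ger0_norm ?divr_ge0 ?(ltW m_gt0)//.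
    by rewrite powRrM powR_mulrn// powR12_sqrt// exprn_ge0.
  exists k0; split=> [|k k0k|k k0k|k k0k].
  + by rewrite D0E.
  + by rewrite KLE lee_fin; exact: rate_le.
  + exact: W1_lin.
  + by apply: le_trans (tri k) _; rewrite lerD2r; exact: W1_lin.
- split=> [K K1|eps K eps0 K1 h_le K_ge].
    have [k kK kW] := best K K1; apply: le_trans kW; apply: ge_inf.
      by exists 0 => _ [j _ <-]; exact: W1_ge0.
    by exists k.
  have [k kK kW] := best K K1.
  by exists k => //; apply: le_trans kW _; exact: small.
- split=> [K K1|eps K eps0 K1 h_le K_ge]; first exact: avg.
  by apply: le_trans (avg K K1) _; exact: small.
Qed.
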